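(* Let $\Lambda$ be a superpartition of total degree $n$ and fermionic degree $m$. Then the antipode $S$ of the Hopf algebra $\mathbf{\Lambda}$ of symmetric functions in superspace satisfies $$S(e_\Lambda)=(-1)^{m+n}h_\Lambda,\qquad S(s_\Lambda)=(-1)^{\binom{m+1}{2}+n}\,\bar s^{*}_{\Lambda'},\qquad S(\bar s_\Lambda)=(-1)^{\binom{m+1}{2}+n}\,s^{*}_{\Lambda'},$$ where $s^*_\Lambda$ and $\bar s^*_\Lambda$ are the bases dual to $s_\Lambda$ and $\bar s_\Lambda$ respectively.
   Context: Let $x_1,x_2,\dots$ be commuting variables and $\theta_1,\theta_2,\dots$ anticommuting variables ($\theta_i\theta_j=-\theta_j\theta_i$, $\theta_i^2=0$). $\mathbf{\Lambda}$ is the ring of formal power series over $\mathbb Q$ of bounded degree in these variables invariant under simultaneous permutation of the pairs $(x_i,\theta_i)$; the fermionic degree is the degree in the $\theta$'s. A superpartition is a pair $\Lambda=(\Lambda^a;\Lambda^s)=(\Lambda_1,\dots,\Lambda_m;\Lambda_{m+1},\dots,\Lambda_N)$, with $\Lambda^a$ a strictly decreasing sequence of $m$ non-negative integers and $\Lambda^s$ a partition. Its fermionic degree is $m$, its total degree is $n=\sum_i\Lambda_i$, and it is said to be of type $(n|m)$. Its diagram is the Ferrers diagram of all its parts, with an extra circle at the end of each row corresponding to a part of $\Lambda^a$ (a circled row is placed before uncircled rows of the same size); the conjugate $\Lambda'$ is the superpartition whose diagram is the reflection of that of $\Lambda$ through the main diagonal. The monomial $m_\Lambda$ is the sum of the distinct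 terms among $\theta_{\sigma(1)}\cdots\theta_{\sigma(m)}x_{\sigma(1)}^{\Lambda_1}\cdots x_{\sigma(N)}^{\Lambda_N}$, $\sigma\in S_N$ ($\Lambda$ padded by zeros), in the limit $N\to\infty$. For $r\ge1$, $k\ge0$: $p_r=\sum_ix_i^r$, $\tilde p_k=\sum_i\theta_ix_i^k$; $e_r=m_{(\emptyset;1^r)}$, $\tilde e_k=m_{(0;1^k)}$; $h_r=\sum m_\Lambda$ over $\Lambda$ of type $(r|0)$, $\tilde h_k=\sum(\Lambda_1+1)m_\Lambda$ over $\Lambda$ of type $(k|1)$. For $g\in\{p,e,h\}$, $g_\Lambda=\tilde g_{\Lambda_1}\cdots\tilde g_{\Lambda_m}g_{\Lambda_{m+1}}\cdots g_{\Lambda_\ell}$, the second group running over the nonzero parts of $\Lambda^s$. For a partition $\lambda$, $z_\lambda=\prod_{i\ge1}i^{n_i}n_i!$ with $n_i$ the number of parts equal to $i$. The scalar product is the bilinear form on $\mathbf{\Lambda}$ with $\langle\!\langle p_\Lambda,p_\Omega\rangle\!\rangle=\delta_{\Lambda\Omega}z_{\Lambda^s}$. Dominance order: let $\Lambda^*$ be the partition obtained by sorting all parts of $\Lambda$, and $\Lambda^{\circledast}$ the partition obtained by sorting after adding 1 to each part of $\Lambda^a$; $\Omega\le\Lambda$ iff $\Omega,\Lambda$ have the same total and fermionic degrees, $\Omega^*\le\Lambda^*$ and $\Omega^\circledast\le\Lambda^\circledast$ in the usual dominance order. The Macdonald polynomials in superspace $P^{(q,t)}_\Lambda$ are the unique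 basis of $\mathbb Q(q,t)\otimes\mathbf{\Lambda}$ such that $P_\Lambda^{(q,t)}=m_\Lambda+$ a linear combination of $m_\Omega$ with $\Omega<\Lambda$, and which is orthogonal for $\langle\!\langle p_\Lambda,p_\Omega\rangle\!\rangle_{q,t}=\delta_{\Lambda\Omega}\,q^{|\Lambda^a|}z_{\Lambda^s}\prod_i\frac{1-q^{\Lambda^s_i}}{1-t^{\Lambda^s_i}}$ (product over nonzero parts of $\Lambda^s$; $|\Lambda^a|$ is the sum of the parts of $\Lambda^a$). The Schur functions in superspace are $s_\Lambda=P_\Lambda^{(0,0)}$ and $\bar s_\Lambda=P_\Lambda^{(\infty,\infty)}$ (the latter meaning: replace $q,t$ by $1/q,1/t$ and then set $q=t=0$); it is known that these specializations exist and give bases of $\mathbf{\Lambda}$. The dual bases are defined by $\langle\!\langle s^*_\Lambda,s_\Omega\rangle\!\rangle=\langle\!\langle\bar s^*_\Lambda,\bar s_\Omega\rangle\!\rangle=\delta_{\Lambda\Omega}$. Known facts that may be used: with $\omega$ the algebra homomorphism such that $\omega(p_r)=(-1)^{r-1}p_r$, $\omega(\tilde p_k)=(-1)^k\tilde p_k$, one has $\omega(e_\Lambda)=h_\Lambda$, $s^*_\Lambda=(-1)^{\binom m2}\omega\bar s_{\Lambda'}$ and $\bar s^*_\Lambda=(-1)^{\binom m2}\omega s_{\Lambda'}$ for $\Lambda$ of fermionic degree $m$. Hopf structure: $\mathbf{\Lambda}\otimes\mathbf{\Lambda}$ is identified with functions of two sets of variables $(x;\theta)$, $(y;\phi)$,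 symmetric in each, with $\theta$'s and $\phi$'s anticommuting with each other; $f\otimes g$ corresponds to $f(x;\theta)g(y;\phi)$. The coproduct is $(\Delta f)(x,y;\theta,\phi)=f(x,y;\theta,\phi)$ ($f$ evaluated on the union of the two sets of variables); the counit $\epsilon$ is the identity on constants and zero on elements homogeneous of positive degree (total plus fermionic). With $\mathrm{mult}$ the multiplication and $u$ the unit map, the antipode $S$ is the unique linear map with $\mathrm{mult}\circ(S\otimes1)\circ\Delta=u\circ\epsilon=\mathrm{mult}\circ(1\otimes S)\circ\Delta$. *)

(* Defs.v *)
From HB Require Import structures.
From mathcomp Require Import all_boot all_order all_algebra.
From mathcomp Require Import finmap multiset.
From mathcomp Require Import zify.
From mathcomp Require Import boolp classical_sets functions cardinality fsbigop.

Set Implicit Arguments.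
Unset Strict Implicit.
Unset Printing Implicit Defensive.
Import Order.TTheory GRing.Theory Num.Theory.
Local Open Scope classical_set_scope.
Local Open Scope ring_scope.

(* The tail of zeros of [L^s] is dropped, so that equality of superpartitions
   is Leibniz equality; [L^a] may end with a significant part 0. *)
Definition is_superpart (p : seq nat * seq nat) : bool :=
  [&& sorted gtn p.1, sorted geq p.2 & 0%N \notin p.2].

Record superpart := Superpart {
  sp_val :> seq nat * seq nat;
  sp_valP : is_superpart sp_val }.
HB.instance Definition _ := [isSub for sp_val].
HB.instance Definition _ := [Choice of superpart by <:].

Definition spa (L : superpart) : seq nat := L.1.
Definition sps (L : superpart) : seq nat := L.2.

Definition fdeg (L : superpart) : nat := size (spa L).
Definition tdeg (L : superpart) : nat := sumn (spa L ++ sps L).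

(* Rows of the diagram, as pairs (number of boxes, is there a circle?). *)
Definition row_before (x y : nat * bool) : bool :=
  (y.1 < x.1)%N || (x.1 == y.1) && (y.2 ==> x.2).

Definition rows (L : superpart) : seq (nat * bool) :=
  sort row_before ([seq (k, true) | k <- spa L] ++ [seq (k, false) | k <- sps L]).

Definition box (L : superpart) (i j : nat) : bool :=
  (j < (nth (0, false) (rows L) i).1)%N.
Definition circle (L : superpart) (i j : nat) : bool :=
  nth (0%N, false) (rows L) i == (j, true).

Definition colh (L : superpart) (j : nat) : nat :=
  count (fun k => j < k)%N (spa L ++ sps L).

(* Column [j] has [colh L j] boxes, and it is circled iff [j] is a part of
   [L^a]; see [box_conj] and [circle_conj] below. *)
Definition conj_val (L : superpart) : seq nat * seq nat :=
  (rev [seq colh L j | j <- spa L],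
   [seq c <- [seq colh L j | j <- iota 0 (tdeg L).+1 & j \notin spa L]
     | (0 < c)%N]).

Lemma colh_anti L i j : (i <= j)%N -> (colh L j <= colh L i)%N.
Proof. by move=> ij; apply: sub_count => k /=; apply: leq_ltn_trans. Qed.

Lemma colh_lt L i j : (i < j)%N -> j \in spa L -> (colh L j < colh L i)%N.
Proof.
move=> ij ja; rewrite /colh !count_cat -addSn leq_add //; last first.
  by apply: sub_count => k /=; apply: ltn_trans.
elim: (spa L) ja => //= k l IH; rewrite inE => /orP[/eqP <-|/IH h]; last lia.
rewrite ij ltnn add0n add1n !ltnS.
by apply: sub_count => k' /=; apply: ltn_trans.
Qed.

Lemma spa_sorted L : sorted gtn (spa L).
Proof. by case/and3P: (sp_valP L). Qed.

Lemma sps_sorted L : sorted geq (sps L).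
Proof. by case/and3P: (sp_valP L). Qed.

Lemma gtn_trans : transitive gtn.
Proof. by move=> y x z /= h1 h2; apply: ltn_trans h1. Qed.

Lemma geq_trans : transitive geq.
Proof. by move=> y x z /= h1 h2; apply: leq_trans h1. Qed.

Lemma conj_valP L : is_superpart (conj_val L).
Proof.
apply/and3P; split.
- have: {subset spa L <= spa L} by [].
  rewrite /= rev_sorted; have := spa_sorted L.
  elim: {1 2 4}(spa L) => // j [|k l] //= IH /andP[jk hs] sub.
  rewrite colh_lt ?sub ?inE ?eqxx // IH // => x xl.
  by apply: sub; rewrite inE xl orbT.
- apply: (sorted_filter geq_trans).
  apply: (@homo_sorted _ _ _ leq); first by move=> i j; apply: colh_anti.
  exact/(sorted_filter leq_trans)/iota_sorted.
- by rewrite mem_filter.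
Qed.

Definition conj (L : superpart) : superpart := Superpart (conj_valP L).

Definition row_key (x : nat * bool) : nat := (x.1.*2 + x.2)%N.

Lemma row_beforeE x y : row_before x y = (row_key y <= row_key x)%N.
Proof.
case: x y => [a b] [c d]; rewrite /row_before /row_key /=.
by case: b d => [] [] /=; rewrite ?andbT ?andbF ?orbF; lia.
Qed.

Lemma nth_rows (r : seq (nat * bool)) k i : sorted row_before r ->
  (k < row_key (nth (0%N, false) r i))%N = (i < count (fun x => k < row_key x) r)%N.
Proof.
have tr : transitive row_before.
  by move=> y x z; rewrite !row_beforeE => h1 h2; apply: leq_trans h1.
elim: r i => [|x r IH] i /=; first by rewrite nth_nil /row_key.
move=> xr; have [kx|kx] := ltnP k (row_key x).
  case: i => [|i] /=; first by rewrite kx.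
  by rewrite IH ?(path_sorted xr).
have /allP hx := order_path_min tr xr.
have -> : count (fun x => k < row_key x)%N r = 0%N.
  apply/eqP; rewrite -leqn0 leqNgt -has_count; apply/hasP => -[y /hx].
  by rewrite row_beforeE; lia.
rewrite ltn0; case: i => [|i] /=; first by lia.
have [ir|ir] := ltnP i (size r); last by rewrite nth_default.
have := hx _ (mem_nth (0%N, false) ir); rewrite row_beforeE => /leq_trans/(_ kx).
by rewrite leqNgt => /negbTE.
Qed.

Lemma rows_sorted L : sorted row_before (rows L).
Proof. by apply: sort_sorted => x y; rewrite !row_beforeE leq_total. Qed.

Lemma count_rows L j : count (fun x => j.*2.+1 < row_key x)%N (rows L) = colh L j.
Proof.
rewrite /rows count_sort count_cat !count_map /colh count_cat.
by congr addn; apply: eq_count => k /=; rewrite /row_key /=; lia.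
Qed.

Lemma boxE L i j : box L i j = (i < colh L j)%N.
Proof.
rewrite -count_rows -nth_rows ?rows_sorted // /box /row_key.
by case: nth => a [] /=; lia.
Qed.

Lemma spa_uniq L : uniq (spa L).
Proof. by apply: (sorted_uniq gtn_trans _ (spa_sorted L)) => x /=; rewrite ltnn. Qed.

Lemma circleE L i j : circle L i j = (j \in spa L) && (i == colh L j).
Proof.
have -> : circle L i j = (j.*2 < row_key (nth (0%N, false) (rows L) i))%N
    && ~~ (j.*2.+1 < row_key (nth (0%N, false) (rows L) i))%N.
  rewrite /circle /row_key; case: nth => a b; rewrite xpair_eqE /=.
  by case: b => /=; rewrite ?andbT ?andbF; lia.
rewrite !nth_rows ?rows_sorted // count_rows.
have -> : count (fun x => j.*2 < row_key x)%N (rows L) = (colh L j + (j \in spa L))%N.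
  rewrite /rows count_sort count_cat !count_map /colh count_cat.
  rewrite -(count_uniq_mem _ (spa_uniq L)).
  have -> : count (preim (pair^~ false) (fun x => j.*2 < row_key x)%N) (sps L)
          = count (fun k => j < k)%N (sps L).
    by apply: eq_count => k /=; rewrite /row_key /=; lia.
  rewrite addnAC; congr addn.
  elim: (spa L) => //= k l ->; rewrite /row_key /= eq_sym; case: eqP => ?; lia.
by case: (j \in spa L); lia.
Qed.

Lemma mem_leq_sumn (s : seq nat) j : j \in s -> (j <= sumn s)%N.
Proof. by elim: s => //= k s IH; rewrite inE => /orP[/eqP->|/IH]; lia. Qed.

Lemma count_iota_prefix (P : pred nat) n : (forall i j, (j <= i)%N -> P i ==> P j) ->
  forall i, (i < count P (iota 0 n))%N = (i < n)%N && P i.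
Proof.
move=> hP; elim: n => [|n IH] i; first by rewrite ltn0.
rewrite -[in iota _ _]addn1 iotaD count_cat /= add0n addn0.
have [Pn|Pn] := boolP (P n).
  have -> : count P (iota 0 n) = n.
    rewrite -[RHS](size_iota 0); apply/eqP; rewrite -all_count.
    apply/allP => k; rewrite mem_iota add0n => /andP[_ kn].
    exact: (implyP (hP _ _ (ltnW kn)) Pn).
  rewrite addn1 ltnS; have [le_in|//] := leqP i n.
  by rewrite (implyP (hP _ _ le_in) Pn).
rewrite addn0 IH ltnS [in RHS]leq_eqVlt; case: eqP => [->|//].
by rewrite ltnn (negbTE Pn).
Qed.

Lemma colh_large L i : (tdeg L <= i)%N -> colh L i = 0%N.
Proof.
move=> h; apply/eqP; rewrite -leqn0 leqNgt -has_count; apply/hasP => -[k /mem_leq_sumn].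
by rewrite -/(tdeg L); lia.
Qed.

Lemma colh_conj L i j : (i < colh (conj L) j)%N = (j < colh L i)%N.
Proof.
have -> : colh (conj L) j = count (fun i => j < colh L i)%N (iota 0 (tdeg L).+1).
  rewrite {1}/colh /spa /sps /= count_cat count_rev count_map.
  rewrite count_filter count_map.
  have -> : count (preim (colh L) (predI (fun k => j < k)%N (fun c => 0 < c)%N))
       [seq j0 <- iota 0 (tdeg L).+1 | j0 \notin spa L] =
     count (fun i => j < colh L i)%N [seq j0 <- iota 0 (tdeg L).+1 | j0 \notin spa L].
    by apply: eq_count => k /=; lia.
  have pe : perm_eq (spa L) [seq k <- iota 0 (tdeg L).+1 | k \in spa L].
    apply: uniq_perm; rewrite ?spa_uniq ?filter_uniq ?iota_uniq // => k.
    rewrite mem_filter mem_iota add0n /= ltnS; case: (boolP (k \in spa L)) => //= ka.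
    by symmetry; apply: mem_leq_sumn; rewrite mem_cat ka.
  rewrite (permP pe) -count_cat.
  exact: (permP (permEl (perm_filterC (mem (spa L)) _))).
rewrite count_iota_prefix; last first.
  by move=> k l kl; apply/implyP => h; apply: leq_trans h (colh_anti _ kl).
case: (boolP (i < (tdeg L).+1)%N) => [//|h].
by rewrite colh_large //; lia.
Qed.

Lemma box_conj L i j : box (conj L) i j = box L j i.
Proof. by rewrite !boxE colh_conj. Qed.

Lemma circle_conj L i j : circle (conj L) i j = circle L j i.
Proof.
have colhK k : k \in spa L -> colh (conj L) (colh L k) = k.
  move=> ka; apply/eqP; rewrite eqn_leq leqNgt colh_conj ltnn /=.
  case: k ka => // k ka; rewrite colh_conj; exact: colh_lt.
rewrite !circleE /= mem_rev; apply/andP/andP => [[/mapP[k ka ->]]|[ia /eqP ->]].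
  by rewrite colhK // => /eqP ->; rewrite ka.
by rewrite colhK // map_f.
Qed.

Definition sp_star (L : superpart) : seq nat := sort geq (spa L ++ sps L).
Definition sp_circ (L : superpart) : seq nat :=
  sort geq ([seq k.+1 | k <- spa L] ++ sps L).

Definition dom_le (l m : seq nat) : Prop :=
  sumn l = sumn m /\ forall k, (sumn (take k l) <= sumn (take k m))%N.

Definition sp_le (M L : superpart) : Prop :=
  [/\ tdeg M = tdeg L, fdeg M = fdeg L,
      dom_le (sp_star M) (sp_star L) & dom_le (sp_circ M) (sp_circ L)].

Definition sp_lt (M L : superpart) : Prop := sp_le M L /\ M <> L.

Definition zpart (l : seq nat) : nat :=
  (\prod_(1 <= i < (sumn l).+1) (i ^ (count_mem i l) * (count_mem i l)`!))%N.

(* [(I, A)] stands for [theta_I x^A], where [theta_I] is the product of the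
   [theta_i], [i] in [I], in increasing order of the indices. *)
Notation smon := ({fset nat} * {mset nat}%mset)%type.

Notation sseries R := (smon -> R^o).
(* Series in (x; theta) and (y; phi): the pair [(m1, m2)] stands for the product
   of [m1] in (x; theta) by [m2] in (y; phi), in this order. *)
Notation sseries2 R := (smon * smon -> R^o).

(* For distinct indices [w_1, ..., w_k], one has
   [theta_(w_1) ... theta_(w_k) = (-1)^(inv w) theta_{w_1, ..., w_k}]. *)
Fixpoint inv (w : seq nat) : nat :=
  if w is i :: w' then (count (fun j => j < i) w' + inv w')%N else 0%N.

Definition thetas (I : {fset nat}) : seq nat := sort leq I.

Definition smon_deg (m : smon) : nat := (#|` m.1| + size m.2)%N.
Definition smon_one : smon := (fset0, mset0).

(* [m1 * m2 = (-1)^(smon_sign m1 m2) (smon_mul m1 m2)] if the theta parts of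
   [m1] and [m2] are disjoint, and [m1 * m2 = 0] otherwise. *)
Definition smon_mul (m1 m2 : smon) : smon :=
  ((m1.1 `|` m2.1)%fset, msetD m1.2 m2.2).
Definition smon_sign (m1 m2 : smon) : nat := inv (thetas m1.1 ++ thetas m2.1).

(* Substitution of [(x_(u i), theta_(u i))] for [(x_i, theta_i)], [u] injective. *)
Definition smon_ren (u : nat -> nat) (m : smon) : smon :=
  ([fset u i | i in m.1]%fset, seq_mset (map u m.2)).
Definition ren_sign (u : nat -> nat) (m : smon) : nat :=
  inv (map u (thetas m.1)).

Section Series.
Variable R : comNzRingType.
Implicit Types (f g : sseries R) (F : sseries2 R).

Definition bounded f : Prop := exists d, forall m, (d < smon_deg m)%N -> f m = 0.

Definition symm f : Prop := forall u : nat -> nat, bijective u ->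
  forall m, f (smon_ren u m) = (-1) ^+ ren_sign u m * f m.

Definition Lam : set (sseries R) := [set f | bounded f /\ symm f].

Definition sone : sseries R := fun m => (m == smon_one)%:R.

(* [f(x; theta) g(y; phi)] *)
Definition tens f g : sseries2 R := fun p => f p.1 * g p.2.

(* The substitution [y = x, phi = theta], whose restriction to the tensor
   square of [Lam] is the multiplication. The sums are finite. *)
Definition smult F : sseries R := fun m =>
  \sum_(p \in [set p : smon * smon |
                [disjoint p.1.1 & p.2.1]%fset /\ smon_mul p.1 p.2 = m])
    (-1) ^+ smon_sign p.1 p.2 * F p.

Definition smul f g : sseries R := smult (tens f g).

(* [f(x, y; theta, phi)], the union of the two sets of variables being
   enumerated by [z_(2i) = x_i] and [z_(2i+1) = y_i]. *)
Definition coprod f : sseries2 R := fun p =>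
  let m1 := smon_ren (fun i => i.*2) p.1 in
  let m2 := smon_ren (fun i => i.*2.+1) p.2 in
  (-1) ^+ smon_sign m1 m2 * f (smon_mul m1 m2).

Definition counit f : R := f smon_one.

Definition linear_on_Lam (S : sseries R -> sseries R) : Prop :=
  [/\ forall f, Lam f -> Lam (S f),
      forall f g, Lam f -> Lam g -> S (f + g) = S f + S g
    & forall c f, Lam f -> S (c *: f) = c *: S f].

(* [S (x) 1] (resp. [1 (x) S]) applies [S] to a function of (x; theta) with
   coefficients depending on (y; phi) (resp. the other way round);
   see [tens_l_pure] and [tens_r_pure]. *)
Definition tens_l (S : sseries R -> sseries R) F : sseries2 R :=
  fun p => S (fun m => F (m, p.2)) p.1.
Definition tens_r (S : sseries R -> sseries R) F : sseries2 R :=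
  fun p => S (fun m => F (p.1, m)) p.2.

Lemma tens_l_pure S f g : linear_on_Lam S -> Lam f ->
  tens_l S (tens f g) = tens (S f) g.
Proof.
case=> _ _ SZ Lf; apply/funext => -[m1 m2]; rewrite /tens_l /tens /=.
have -> : (fun m => f m * g m2) = g m2 *: f.
  by apply/funext => m; rewrite mulrC.
by rewrite SZ // [RHS]mulrC.
Qed.

Lemma tens_r_pure S f g : linear_on_Lam S -> Lam g ->
  tens_r S (tens f g) = tens f (S g).
Proof.
case=> _ _ SZ Lg; apply/funext => -[m1 m2]; rewrite /tens_r /tens /=.
by have -> : (fun m => f m1 * g m) = f m1 *: g by []; rewrite SZ.
Qed.

Definition is_antipode (S : sseries R -> sseries R) : Prop :=
  [/\ linear_on_Lam S,
      forall f, Lam f -> smult (tens_l S (coprod f)) = counit f *: sone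
    & forall f, Lam f -> smult (tens_r S (coprod f)) = counit f *: sone].

(* The term [theta_(v_1) ... theta_(v_m) x_(v_1)^(L_1) x_(v_2)^(L_2) ...], [v]
   being the list of the first [size (a ++ s)] values of a permutation, as
   a sign and a monomial. *)
Definition mono_term (a s v : seq nat) : bool * smon :=
  (odd (inv (take (size a) v)),
   ([fset i in take (size a) v]%fset,
    seq_mset (flatten [seq nseq p.2 p.1 | p <- zip v (a ++ s)]))).

(* [b] ranges over a set of signs, so that a term obtained from several [v]
   (equal parts in [s]) is counted once. *)
Definition mono (a s : seq nat) : sseries R := fun m =>
  \sum_(b \in [set b : bool | exists v : seq nat,
                 [/\ uniq v, size v = size (a ++ s) & mono_term a s v = (b, m)]])
    (-1 : R) ^+ (b : nat).

Definition sp_mono (L : superpart) : sseries R := mono (spa L) (sps L).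

Definition pow_s (r : nat) : sseries R :=
  fun m => \sum_(i \in [set: nat]) ((m == (fset0, msetn r i))%:R : R).
Definition pow_a (k : nat) : sseries R :=
  fun m => \sum_(i \in [set: nat]) ((m == ([fset i]%fset, msetn k i))%:R : R).

Definition elem_s (r : nat) : sseries R := mono [::] (nseq r 1%N).
Definition elem_a (k : nat) : sseries R := mono [:: 0%N] (nseq k 1%N).

Definition hom_s (r : nat) : sseries R :=
  \sum_(L \in [set L : superpart | tdeg L = r /\ fdeg L = 0%N]) sp_mono L.
Definition hom_a (k : nat) : sseries R :=
  \sum_(L \in [set L : superpart | tdeg L = k /\ fdeg L = 1%N])
    (head 0%N (spa L)).+1%:R *: sp_mono L.

Definition sp_prod (ga gs : nat -> sseries R) (L : superpart) : sseries R :=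
  smul (\big[smul/sone]_(k <- spa L) ga k) (\big[smul/sone]_(r <- sps L) gs r).

Definition sp_pow := sp_prod pow_a pow_s.
Definition sp_elem := sp_prod elem_a elem_s.
Definition sp_hom := sp_prod hom_a hom_s.

Definition is_omega (om : sseries R -> sseries R) : Prop :=
  [/\ linear_on_Lam om,
      om sone = sone /\
        (forall f g, Lam f -> Lam g -> om (smul f g) = smul (om f) (om g)),
      forall r, (0 < r)%N -> om (pow_s r) = (-1) ^+ r.-1 *: pow_s r
    & forall k, om (pow_a k) = (-1) ^+ k *: pow_a k].

Definition bilinear_on_Lam (B : sseries R -> sseries R -> R) : Prop :=
  forall c f g h, Lam f -> Lam g -> Lam h ->
    B (c *: f + g) h = c * B f h + B g h /\
    B h (c *: f + g) = c * B h f + B h g.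

Definition is_scalar_product (w : superpart -> R)
    (B : sseries R -> sseries R -> R) : Prop :=
  bilinear_on_Lam B /\
  forall L M, B (sp_pow L) (sp_pow M) = if L == M then w L else 0.

Definition is_basis (b : superpart -> sseries R) : Prop :=
  [/\ forall L, Lam (b L),
      forall f, Lam f -> exists s : seq (R * superpart),
        f = \sum_(p <- s) p.1 *: b p.2
    & forall (s : seq superpart) (c : superpart -> R), uniq s ->
        \sum_(L <- s) c L *: b L = 0 -> forall L, L \in s -> c L = 0].

Definition is_dual (B : sseries R -> sseries R -> R)
    (b' b : superpart -> sseries R) : Prop :=
  (forall L, Lam (b' L)) /\ forall L M, B (b' L) (b M) = (L == M)%:R.

Definition is_macdonald (B : sseries R -> sseries R -> R)
    (P : superpart -> sseries R) : Prop :=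
  [/\ is_basis P,
      forall L, exists2 s : seq (R * superpart),
        (forall p, p \in s -> sp_lt p.2 L) &
        P L = sp_mono L + \sum_(p <- s) p.1 *: sp_mono p.2
    & forall L M, L <> M -> B (P L) (P M) = 0].

End Series.

(* Polynomials in [t] with coefficients polynomials in [q]. *)
Notation Qpoly_qt := {poly {poly rat}}.
Notation Qqt := {fraction Qpoly_qt}.

Definition qpar : Qqt := tofrac ('X%:P : Qpoly_qt).
Definition tpar : Qqt := tofrac ('X : Qpoly_qt).

Definition Qqt_cst (c : rat) : Qqt := tofrac (c%:P%:P : Qpoly_qt).

(* [a(1/q, 1/t)] *)
Definition eval_inv (a : Qpoly_qt) : Qqt :=
  (map_poly (fun c : {poly rat} => (map_poly Qqt_cst c).[qpar^-1]) a).[tpar^-1].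

(* [F] is regular at [q = t = 0], with value [c]. *)
Definition spec_zero (F : Qqt) (c : rat) : Prop :=
  exists a b : Qpoly_qt, [/\ b.[0].[0] != 0, F = tofrac a / tofrac b
                           & c = a.[0].[0] / b.[0].[0]].

(* [F(1/q, 1/t)] is regular at [q = t = 0], with value [c]. *)
Definition spec_infty (F : Qqt) (c : rat) : Prop :=
  exists a b : Qpoly_qt, [/\ b != 0, F = tofrac a / tofrac b
                           & spec_zero (eval_inv a / eval_inv b) c].

Definition sseries_spec (spec : Qqt -> rat -> Prop)
    (P : superpart -> sseries Qqt) (s : superpart -> sseries rat) : Prop :=
  forall L m, spec (P L m) (s L m).

Definition weight (L : superpart) : rat := (zpart (sps L))%:R.
Definition weight_qt (L : superpart) : Qqt :=
  qpar ^+ sumn (spa L) * (zpart (sps L))%:R *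
  \prod_(r <- sps L) ((1 - qpar ^+ r) / (1 - tpar ^+ r)).

(* Main.v *)
From mathcomp Require Import all_boot all_order all_algebra.
From mathcomp Require Import finmap multiset zify ring.
From mathcomp Require Import boolp classical_sets functions cardinality fsbigop.
Require Import Defs.

(** The antipode equals [(-1)^(m+n) omega] on the elements of [Lam] of type
    [(n|m)]; everything else follows from the given dualities and from
    [omega e = h].

    The power sums [p_r], [\tilde p_k] are primitive, so the coproduct of a word
    [p_w] in them is the signed sum of its splittings [p_u (x) p_v], and each
    signed product [p_u p_v] is [p_w] again.  The antipode axiom and induction on
    the length then give [S p_w = (-1)^|w| p_w], because the alternating sum over
    all splittings of a nonempty word vanishes.  The [p_L] span: they are linearly
    independent, since the scalar product makes them orthogonal with nonzero norms,
    and a symmetric function of type [(n|m)] is determined by its values at one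
    monomial per superpartition of type [(n|m)], so a dimension count concludes.

    The equality [omega e = h] comes from the Newton-type identities
    [r e_r = sum (-1)^(j-1) p_j e_(r-j)], [r h_r = sum p_j h_(r-j)],
    [\tilde e_k = sum (-1)^j \tilde p_j e_(k-j)], [\tilde h_k = sum \tilde p_j h_(k-j)]. *)

Set Implicit Arguments.
Unset Strict Implicit.
Unset Printing Implicit Defensive.
Import Order.TTheory GRing.Theory Num.Theory.
Local Open Scope ring_scope.

(** * Signs of shuffles *)

(** [S] is given only as a linear map on [Lam], neither multiplicative nor continuous, so it can be
    compared with [omega] only on finite combinations. This forces a genuine spanning statement, and
    every function involved must be shown to be of a single type before $(-1)^{m+n}$ makes sense.
    The sign itself arises letter by letter. On a word in the power sums $S$ contributes $-1$ per
    letter (the reversal expected of an antipode is absorbed by supercommutativity), while $\omega$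
    contributes $(-1)^{r-1}$ for $p_r$ and $(-1)^k$ for $\tilde p_k$; the products are $(-1)^r$ and
    $(-1)^{k+1}$. The Schur functions are known only through coefficientwise specialization of the
    Macdonald basis, so their symmetry and homogeneity have to be carried through that limit. *)

Definition crossings (v w : seq nat) : nat :=
  (\sum_(a <- v) count (fun b => b < a) w)%N.

Lemma inv_cat v w : inv (v ++ w) = (inv v + inv w + crossings v w)%N.
Proof.
rewrite /crossings; elim: v => [|a v IH] /=; first by rewrite big_nil addn0.
by rewrite big_cons count_cat IH; lia.
Qed.

Lemma crossings_perm v v' w w' :
  perm_eq v v' -> perm_eq w w' -> crossings v w = crossings v' w'.
Proof.
move=> vv' ww'; rewrite /crossings (perm_big _ vv').
by apply: eq_bigr => a _; apply/permP.
Qed.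

Lemma inv_map_sorted_homo (u : nat -> nat) w : {homo u : x y / (x <= y)%N} ->
  sorted leq w -> inv (map u w) = 0%N.
Proof.
move=> hu; elim: w => //= a w IH; rewrite (path_sortedE leq_trans) => /andP[/allP aw sw].
rewrite IH // addn0; apply/eqP; rewrite -leqn0 leqNgt -has_count.
by apply/hasP => -[_ /mapP[b /aw ab ->]]; rewrite ltnNge hu.
Qed.

Lemma inv_thetas (I : {fset nat}) : inv (thetas I) = 0%N.
Proof.
by rewrite -[thetas I]map_id (@inv_map_sorted_homo id) // sort_sorted.
Qed.

Lemma perm_thetas (I : {fset nat}) : perm_eq (thetas I) I.
Proof. exact: permEl (perm_sort _ _). Qed.

Lemma thetas_uniq (I : {fset nat}) : uniq (thetas I).
Proof. by rewrite sort_uniq fset_uniq. Qed.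

Lemma mem_thetas (I : {fset nat}) : thetas I =i I.
Proof. by move=> x; rewrite mem_sort. Qed.

Lemma perm_thetas_uniq (I : {fset nat}) w :
  uniq w -> w =i I -> perm_eq (thetas I) w.
Proof.
by move=> uw wI; apply: uniq_perm; rewrite ?thetas_uniq // => x; rewrite mem_thetas wI.
Qed.

(** The two theta words are increasing, so all inversions of their concatenation are crossings;
    these depend only on the underlying sets, which frees later sign computations from sorted
    lists. *)
Lemma smon_signE (m1 m2 : smon) : smon_sign m1 m2 = crossings m1.1 m2.1.
Proof.
by rewrite /smon_sign inv_cat !inv_thetas; apply: crossings_perm (perm_thetas _) (perm_thetas _).
Qed.

Lemma perm_fsetU (I J : {fset nat}) : [disjoint I & J]%fset ->
  perm_eq (I `|` J)%fset (I ++ J).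
Proof.
move=> dIJ; apply: uniq_perm; rewrite ?fset_uniq //.
  rewrite cat_uniq !fset_uniq andbT; apply/hasPn => x /= xJ.
  by apply/negP => xI; have/fdisjointP/(_ x xI) := dIJ; rewrite xJ.
by move=> x; rewrite mem_cat inE.
Qed.

Lemma crossings_catl v v' w : crossings (v ++ v') w = (crossings v w + crossings v' w)%N.
Proof. by rewrite /crossings big_cat. Qed.

Lemma crossings_catr v w w' : crossings v (w ++ w') = (crossings v w + crossings v w')%N.
Proof. by rewrite /crossings -big_split; apply: eq_bigr => a _; rewrite count_cat. Qed.

Lemma crossingsUl (I J K : {fset nat}) : [disjoint I & J]%fset ->
  crossings (I `|` J)%fset K = (crossings I K + crossings J K)%N.
Proof.
by move=> /perm_fsetU h; rewrite (crossings_perm h (perm_refl _)) crossings_catl.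
Qed.

Lemma crossingsUr (I J K : {fset nat}) : [disjoint J & K]%fset ->
  crossings I (J `|` K)%fset = (crossings I J + crossings I K)%N.
Proof.
by move=> /perm_fsetU h; rewrite (crossings_perm (perm_refl _) h) crossings_catr.
Qed.

Lemma crossings0s w : crossings [::] w = 0%N.
Proof. by rewrite /crossings big_nil. Qed.

Lemma crossings_cons a v w :
  crossings (a :: v) w = (count (fun b => b < a) w + crossings v w)%N.
Proof. by rewrite /crossings big_cons. Qed.

Lemma crossingss0 v : crossings v [::] = 0%N.
Proof. by elim: v => [|a v IH]; rewrite ?crossings0s // crossings_cons IH. Qed.

(** Each pair of distinct entries is counted by exactly one of the two terms. Exchanging two theta
    words thus costs $(-1)^{|v||w|}$, the sign of supercommutativity. *)
Lemma crossings_sym v w : ~~ has (mem v) w ->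
  (crossings v w + crossings w v)%N = (size v * size w)%N.
Proof.
elim: v w => [|a v IH] w hvw; first by rewrite crossings0s crossingss0.
have/IH {}IH : ~~ has (mem v) w.
  by apply: contra hvw => /hasP[x xw /= xv]; apply/hasP; exists x; rewrite //= inE xv orbT.
have aw : a \notin w by apply: contra hvw => aw; apply/hasP; exists a; rewrite //= mem_head.
have -> : crossings w (a :: v) = (count (fun b => a < b)%N w + crossings w v)%N.
  rewrite /crossings -[count _ w]sum1_count [in RHS]big_mkcond /= -big_split.
  by apply: eq_bigr => b _ /=; case: ltnP.
have : (count (fun b => b < a) w + count (fun b => a < b) w = size w)%N.
  rewrite -(count_predC (fun b => b < a)%N w); congr addn; apply: eq_in_count => b bw /=.
  by rewrite -leqNgt ltn_neqAle; case: eqP => // ab; rewrite ab bw in aw.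
by move=> h; rewrite crossings_cons /= mulSn addnACA IH h.
Qed.

Lemma crossings_symU (I J : {fset nat}) : [disjoint I & J]%fset ->
  (crossings I J + crossings J I)%N = (#|` I| * #|` J|)%N.
Proof.
move=> dIJ; rewrite crossings_sym //; apply/hasPn => x xJ; apply/negP => /= xI.
by have/fdisjointP/(_ x xI) := dIJ; rewrite xJ.
Qed.

Lemma crossings_map (u : nat -> nat) v w :
  {mono u : x y / (x < y)%N} -> crossings (map u v) (map u w) = crossings v w.
Proof.
move=> hu; rewrite /crossings big_map; apply: eq_bigr => a _.
by rewrite count_map; apply: eq_count => b /=; rewrite hu.
Qed.

(** Bringing [x] to the front takes one adjacent transposition per entry of [p]. *)
Lemma inv_move x p q : x \notin p ->
  odd (inv (p ++ x :: q)) = odd (inv (x :: p ++ q) + size p).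
Proof.
move=> xp; have h : (crossings p [:: x] + crossings [:: x] p)%N = size p.
  by rewrite crossings_sym ?muln1 //= orbF.
have : (inv (p ++ x :: q) + crossings [:: x] p = inv (x :: p ++ q) + crossings p [:: x])%N.
  rewrite -[x :: q]cat1s -[x :: p ++ q]cat1s !inv_cat !crossings_catr; lia.
lia.
Qed.

(* For distinct [a] and [b], the parity of [(b < a) + (u b < u a)] is symmetric
   in [a] and [b]. *)
Lemma inv_map_perm (u : nat -> nat) v w : injective u -> perm_eq v w -> uniq v ->
  odd (inv (map u v) + inv v) = odd (inv (map u w) + inv w).
Proof.
move=> uI; elim: v w => [|x v IH] w; first by move/perm_size/esym/size0nil ->.
move=> pw /=/andP[xv uv]; have xw : x \in w by rewrite -(perm_mem pw) mem_head.
have uw : uniq w by rewrite -(perm_uniq pw) /= xv.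
case/splitPr: xw pw uw => p q pw.
rewrite cat_uniq /= negb_or => /and3P[_ /andP[xp _] _].
have {}pw : perm_eq v (p ++ q).
  by rewrite -(perm_cons x) (perm_trans pw) // perm_catC /= perm_cons perm_catC.
rewrite oddD [in RHS]oddD map_cat [map u (x :: q)]/= !inv_move ?mem_map // -map_cat /=.
rewrite !count_map size_map !oddD.
have -> : count (preim u (fun j => j < u x)%N) v = count (preim u (fun j => j < u x)%N) (p ++ q).
  exact/permP.
have -> : count (fun j => j < x)%N v = count (fun j => j < x)%N (p ++ q) by exact/permP.
by have := IH _ pw uv; rewrite !oddD; do 7!case: (odd _).
Qed.

(** [ren_sign] is defined through the sorted enumeration; any enumeration [w] may replace it once
    the inversions of [w] itself are added. *)
Lemma inv_map_sort (u : nat -> nat) (I : {fset nat}) w : injective u ->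
  uniq w -> w =i I -> odd (inv (map u (thetas I))) = odd (inv (map u w) + inv w).
Proof.
move=> uI uw wI; rewrite -(inv_map_perm uI (perm_thetas_uniq uw wI)) ?thetas_uniq //.
by rewrite inv_thetas addn0.
Qed.

(** * The superalgebra of series *)

Local Open Scope mset_scope.

Lemma signr_parity (R : pzRingType) a b : odd a = odd b -> (-1) ^+ a = (-1) ^+ b :> R.
Proof. by move=> ab; rewrite -signr_odd ab signr_odd. Qed.

Lemma smonP (m1 m2 : smon) : m1.1 =i m2.1 -> m1.2 =1 m2.2 -> m1 = m2.
Proof. by case: m1 m2 => [I A] [J B] /= /fsetP -> /msetP ->. Qed.

Lemma smon_mulA m1 m2 m3 : smon_mul m1 (smon_mul m2 m3) = smon_mul (smon_mul m1 m2) m3.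
Proof. by rewrite /smon_mul /= fsetUA msetDA. Qed.

Lemma smon_mulC m1 m2 : smon_mul m1 m2 = smon_mul m2 m1.
Proof. by rewrite /smon_mul fsetUC msetDC. Qed.

Lemma smon_mul1 m : smon_mul smon_one m = m.
Proof. by case: m => I A; rewrite /smon_mul /= fset0U mset0D. Qed.

Lemma smon_mul_disj m1 m2 m3 :
  [disjoint m1.1 & m2.1]%fset && [disjoint (smon_mul m1 m2).1 & m3.1]%fset =
  [disjoint m2.1 & m3.1]%fset && [disjoint m1.1 & (smon_mul m2 m3).1]%fset.
Proof.
by rewrite /= fdisjointUX fdisjointXU; do 3!case: [disjoint _ & _]%fset.
Qed.

Definition divisors_set (m : smon) : set (smon * smon) :=
  [set p | [disjoint p.1.1 & p.2.1]%fset /\ smon_mul p.1 p.2 = m].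

Lemma finite_msubset (A : {mset nat}) : finite_set [set B : {mset nat} | msubset B A].
Proof.
rewrite -(seq_mset_id A); elim: (enum_mset A) => [|x s IH].
  apply: (@sub_finite_set _ _ [set mset0]) => [B /= /msubsetP h|]; last exact: finite_set1.
  by apply/msetP => i; have := h i; rewrite mset_seqE mset0E leqn0 => /eqP.
apply: (@sub_finite_set _ _ ([set B : {mset nat} | msubset B (seq_mset s)] `|`
    [set (x +` B)%mset | B in [set B : {mset nat} | msubset B (seq_mset s)]])%classic); last first.
  by rewrite finite_setU; split=> //; apply: finite_image.
move=> B /= /msubsetP h; have [xB|xB] := boolP (x \in B); last first.
  left; apply/msubsetP => i; have := h i; rewrite !mset_seqE /=.
  by case: eqP => // <- _; rewrite (mset_eq0P xB).
right; exists (B `\ x); last exact: msetB1K.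
by apply/msubsetP => i; have := h i; rewrite msetB1E !mset_seqE /= eq_sym; lia.
Qed.

(** A sum over a set is 0 by convention when its support is infinite; finiteness is what makes
    [smult] a true sum. *)
Lemma finite_divisors m : finite_set (divisors_set m).
Proof.
case: m => I A; pose X : set smon := ([set` fpowerset I] `*` [set B : {mset nat} | msubset B A])%classic.
apply: (@sub_finite_set _ _ (X `*` X)%classic); last first.
  by apply: finite_setX; apply: finite_setX; (exact: finite_fset || exact: finite_msubset).
move=> [[J B] [K C]] [_ /= [eI eA]]; split; split=> /=; rewrite -?eI -?eA ?fpowersetE;
  rewrite ?fsubsetUl ?fsubsetUr //; apply/msubsetP => x; rewrite msetE2; lia.
Qed.

Definition divisors m : seq (smon * smon) := fset_set (divisors_set m).

Lemma mem_divisors p m :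
  (p \in divisors m) = [disjoint p.1.1 & p.2.1]%fset && (smon_mul p.1 p.2 == m).
Proof.
rewrite in_fset_set; last exact: finite_divisors.
apply/idP/andP; first by rewrite inE /= => -[d /eqP e].
by move=> [d /eqP e]; rewrite inE.
Qed.

Lemma divisors_uniq m : uniq (divisors m).
Proof. exact: fset_uniq. Qed.

(** Both lists enumerate the factorizations of [m] into three monomials with pairwise disjoint theta
    parts: the reindexing behind associativity. *)
Lemma divisors_triples m :
  perm_eq [seq (p.1, r.1, r.2) | p <- divisors m, r <- divisors p.2]
          [seq (r.1, r.2, p.2) | p <- divisors m, r <- divisors p.1].
Proof.
apply: uniq_perm.
- apply: allpairs_uniq_dep; rewrite ?divisors_uniq //; first by move=> p _; exact: divisors_uniq.
  move=> x y /allpairsPdep[[p1 p2] [[r1 r2] [_ + ->]]] /allpairsPdep[[q1 q2] [[s1 s2] [_ + ->]]].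
  rewrite !mem_divisors /= => /andP[_ /eqP e1] /andP[_ /eqP e2] [-> e3 e4].
  by rewrite e3 e4 e2 in e1; rewrite -e1 e3 e4.
- apply: allpairs_uniq_dep; rewrite ?divisors_uniq //; first by move=> p _; exact: divisors_uniq.
  move=> x y /allpairsPdep[[p1 p2] [[r1 r2] [_ + ->]]] /allpairsPdep[[q1 q2] [[s1 s2] [_ + ->]]].
  rewrite !mem_divisors /= => /andP[_ /eqP e1] /andP[_ /eqP e2] [e3 e4 ->].
  by rewrite e3 e4 e2 in e1; rewrite -e1 e3 e4.
- move=> t; apply/allpairsPdep/allpairsPdep.
  + move=> [p [r [+ + ->]]]; rewrite !mem_divisors => /andP[d1 /eqP e1] /andP[d2 /eqP e2].
    rewrite -e2 in d1; have := smon_mul_disj p.1 r.1 r.2; rewrite d1 d2 => /andP[d3 d4].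
    exists (smon_mul p.1 r.1, r.2), (p.1, r.1); rewrite !mem_divisors /= d3 d4 eqxx.
    by rewrite -smon_mulA e2 e1 eqxx.
  + move=> [p [r [+ + ->]]]; rewrite !mem_divisors => /andP[d1 /eqP e1] /andP[d2 /eqP e2].
    rewrite -e2 in d1; have := smon_mul_disj r.1 r.2 p.2; rewrite d1 d2 => /esym/andP[d3 d4].
    exists (r.1, smon_mul r.2 p.2), (r.2, p.2); rewrite !mem_divisors /= d3 d4 eqxx.
    by rewrite smon_mulA e2 e1 eqxx.
Qed.

Section SuperAlgebra.
Variable R : comNzRingType.
Implicit Types (f g h : sseries R) (F : sseries2 R).

Lemma smultE F m :
  smult F m = \sum_(p <- divisors m) (-1) ^+ crossings p.1.1 p.2.1 * F p.
Proof.
rewrite /smult (fsbig_finite _ _ (finite_divisors m)).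
by apply: eq_bigr => p _; rewrite smon_signE.
Qed.

Lemma smulA f g h : smul f (smul g h) = smul (smul f g) h.
Proof.
apply/funext => m; rewrite /smul !smultE /tens.
(* Either bracketing produces the crossings of all three pairs of factors. *)
pose G (t : smon * smon * smon) : R :=
  (-1) ^+ (crossings t.1.1.1 t.1.2.1 + crossings t.1.1.1 t.2.1 + crossings t.1.2.1 t.2.1)
  * (f t.1.1 * g t.1.2 * h t.2).
transitivity (\sum_(t <- [seq (p.1, r.1, r.2) | p <- divisors m, r <- divisors p.2]) G t).
  rewrite big_allpairs_dep; apply: eq_bigr => p _.
  rewrite smultE !mulr_sumr !big_seq; apply: eq_bigr => r.
  rewrite mem_divisors => /andP[d /eqP <-]; rewrite /G /= crossingsUr //.
  by rewrite !exprD; ring.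
rewrite (perm_big _ (divisors_triples m)) big_allpairs_dep; apply: eq_bigr => p _.
rewrite smultE mulr_suml mulr_sumr !big_seq; apply: eq_bigr => r.
rewrite mem_divisors => /andP[d /eqP <-]; rewrite /G /= crossingsUl //.
by rewrite !exprD; ring.
Qed.

Definition fermionic k f := forall m, f m != 0 -> #|` m.1| = k.

Lemma smulC a b f g : fermionic a f -> fermionic b g ->
  smul f g = (-1) ^+ (a * b) *: smul g f.
Proof.
move=> ha hb; apply/funext => m; rewrite /smul smultE [RHS]/=.
rewrite [X in _ = X](_ : _ = (-1) ^+ (a * b) * smult (tens g f) m) // smultE mulr_sumr.
have pe : perm_eq (divisors m) (map (fun p => (p.2, p.1)) (divisors m)).
  apply: uniq_perm; rewrite ?map_inj_uniq ?divisors_uniq //; first by move=> [? ?] [? ?] [-> ->].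
  move=> p; apply/idP/mapP => [pm|[q qm ->]].
    exists (p.2, p.1); last by case: p pm.
    by move: pm; rewrite !mem_divisors /= smon_mulC fdisjoint_sym.
  by move: qm; rewrite !mem_divisors /= smon_mulC fdisjoint_sym.
rewrite (perm_big _ pe) big_map !big_seq; apply: eq_bigr => p.
rewrite mem_divisors => /andP[d _]; rewrite /tens /=.
have [->|/ha <-] := eqVneq (f p.2) 0; first by rewrite mul0r !mulr0.
have [->|/hb <-] := eqVneq (g p.1) 0; first by rewrite mul0r !mulr0.
rewrite mulnC -crossings_symU // mulrA -exprD [f _ * _]mulrC.
by congr (_ * _); apply: signr_parity; rewrite addnAC addnn oddD odd_double.
Qed.

Lemma smul1 f : smul (@sone R) f = f.
Proof.
apply/funext => m; rewrite /smul smultE (bigD1_seq (smon_one, m)) ?divisors_uniq //=; last first.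
  by rewrite mem_divisors /= smon_mul1 fdisjoint0X eqxx.
rewrite crossings0s mul1r {1}/tens /sone eqxx mul1r big_seq_cond big1 ?addr0 //.
move=> [p1 p2]; have -> : tens (fun m => (m == smon_one)%:R : R) f (p1, p2)
  = (p1 == smon_one)%:R * f p2 by [].
have [->|/negPf n1] := eqVneq p1 smon_one; last by rewrite mul0r mulr0.
by rewrite mem_divisors smon_mul1 xpair_eqE eqxx => /andP[/andP[_ ->]].
Qed.

Lemma smulr1 f : smul f (@sone R) = f.
Proof.
apply/funext => m; rewrite /smul smultE (bigD1_seq (m, smon_one)) ?divisors_uniq //=; last first.
  by rewrite mem_divisors smon_mulC smon_mul1 fdisjointX0 eqxx.
rewrite crossingss0 mul1r {1}/tens /sone eqxx mulr1 big_seq_cond big1 ?addr0 //.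
move=> [p1 p2]; have -> : tens f (fun m => (m == smon_one)%:R : R) (p1, p2)
  = f p1 * (p2 == smon_one)%:R by [].
have [->|/negPf n1] := eqVneq p2 smon_one; last by rewrite !mulr0.
by rewrite mem_divisors smon_mulC smon_mul1 xpair_eqE eqxx andbT => /andP[/andP[_ ->]].
Qed.

Lemma fermionic_one : fermionic 0 (@sone R).
Proof. by move=> m; rewrite /sone; case: (m =P smon_one) => [-> _|_]; rewrite ?cardfs0 ?eqxx. Qed.

Lemma fermionic_mul a b f g : fermionic a f -> fermionic b g -> fermionic (a + b) (smul f g).
Proof.
move=> ha hb m; rewrite /smul smultE; apply: contra_neq_eq => mab; rewrite big_seq big1 // => p.
rewrite mem_divisors => /andP[d /eqP e]; rewrite /tens.
have [->|/ha fa] := eqVneq (f p.1) 0; first by rewrite mul0r mulr0.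
have [->|/hb gb] := eqVneq (g p.2) 0; first by rewrite !mulr0.
by move: mab; rewrite -e /= cardfsU (disjoint_fsetI0 d) cardfs0 subn0 fa gb eqxx.
Qed.

End SuperAlgebra.

(** * Renaming variables; closure properties *)

Lemma perm_msetD (A B : {mset nat}) : perm_eq (A `+` B) ((A : seq nat) ++ B).
Proof. by apply/allP => x _ /=; rewrite count_cat !count_mem_mset msetE2. Qed.

Lemma size_msetD (A B : {mset nat}) : size (A `+` B) = (size A + size B)%N.
Proof. by rewrite (perm_size (perm_msetD A B)) size_cat. Qed.

Lemma perm_imfset (u : nat -> nat) (I : {fset nat}) : injective u ->
  perm_eq (u @` I)%fset (map u I).
Proof.
move=> uI; apply: uniq_perm; rewrite ?map_inj_uniq ?fset_uniq //.
by move=> x; apply/imfsetP/mapP => -[y yI ->]; exists y.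
Qed.

Lemma smon_renE u m j : (smon_ren u m).2 j = count (fun i => u i == j) m.2.
Proof. by rewrite /smon_ren /= mset_seqE count_map. Qed.

Lemma smon_ren_mul u m1 m2 :
  smon_ren u (smon_mul m1 m2) = smon_mul (smon_ren u m1) (smon_ren u m2).
Proof.
apply: smonP => [x|j]; first by rewrite /smon_ren /= imfsetU.
by rewrite [RHS]msetE2 !smon_renE (permP (perm_msetD _ _)) count_cat.
Qed.

Lemma smon_ren_comp u v m : smon_ren v (smon_ren u m) = smon_ren (v \o u) m.
Proof.
apply: smonP => [x|j]; last first.
  by rewrite !smon_renE (permP (perm_eq_seq_mset _)) count_map.
apply/imfsetP/imfsetP => /= [[y /imfsetP[z zm -> ->]]|[z zm ->]]; first by exists z.
by exists (u z) => //; apply/imfsetP; exists z.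
Qed.

Lemma smon_ren_id u m : u =1 id -> smon_ren u m = m.
Proof.
move=> uid; apply: smonP => [x|j].
  by apply/imfsetP/idP => /= [[y ym ->]|xm]; rewrite ?uid //; exists x; rewrite ?uid.
by rewrite smon_renE -[RHS]count_mem_mset; apply: eq_count => i /=; rewrite uid.
Qed.

Lemma smon_ren_inj u : injective u -> injective (smon_ren u).
Proof.
move=> uI m1 m2 e; apply: smonP => [x|j].
  by have /fsetP/(_ (u x)) := congr1 fst e; rewrite !mem_imfset.
have : (smon_ren u m1).2 (u j) = (smon_ren u m2).2 (u j) by rewrite e.
rewrite !smon_renE; have h : (fun i => u i == u j) =1 pred1 j by move=> i; rewrite (inj_eq uI).
by rewrite !(eq_count h) !count_mem_mset.
Qed.

Lemma disjoint_smon_ren u m1 m2 : injective u ->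
  [disjoint (smon_ren u m1).1 & (smon_ren u m2).1]%fset = [disjoint m1.1 & m2.1]%fset.
Proof.
move=> uI; apply/fdisjointP/fdisjointP => h x.
  by move=> xm; have := h (u x); rewrite !mem_imfset //; apply.
by move=> /imfsetP[y ym ->]; rewrite mem_imfset //; apply: h.
Qed.

Lemma card_smon_ren u m : injective u -> #|` (smon_ren u m).1| = #|` m.1|.
Proof. by move=> uI; rewrite card_imfset. Qed.

Lemma smon_ren_one u : smon_ren u smon_one = smon_one.
Proof.
apply: smonP => [x|j]; first by rewrite inE; apply/imfsetP => -[].
by rewrite smon_renE mset0E enum_mset0.
Qed.

(** The concatenation [w] of the two sorted theta words enumerates the product; its inversions,
    before and after [u], split into those inside each word and the crossings. *)
Lemma ren_sign_mul u m1 m2 : injective u -> [disjoint m1.1 & m2.1]%fset ->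
  odd (ren_sign u (smon_mul m1 m2)) =
  odd (ren_sign u m1 + ren_sign u m2 + crossings (smon_ren u m1).1 (smon_ren u m2).1
       + crossings m1.1 m2.1).
Proof.
move=> uI d; pose w := thetas m1.1 ++ thetas m2.1.
have pw : perm_eq (thetas (m1.1 `|` m2.1)%fset) w.
  apply: perm_trans (perm_thetas _) _; apply: perm_trans (perm_fsetU d) _.
  by apply: perm_cat; rewrite perm_sym perm_thetas.
rewrite /ren_sign /= (@inv_map_sort u _ w) //; last first.
- by move=> x; rewrite -(perm_mem pw) mem_thetas.
- by rewrite -(perm_uniq pw) thetas_uniq.
rewrite map_cat !inv_cat !inv_thetas add0n.
rewrite (@crossings_perm (map u _) (smon_ren u m1).1 (map u _) (smon_ren u m2).1).
- by rewrite (crossings_perm (perm_thetas _) (perm_thetas _)).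
- by rewrite perm_sym (perm_trans (perm_imfset _ uI)) // perm_map // perm_sym perm_thetas.
- by rewrite perm_sym (perm_trans (perm_imfset _ uI)) // perm_map // perm_sym perm_thetas.
Qed.

Lemma ren_sign_small u m : (#|` m.1| <= 1)%N -> ren_sign u m = 0%N.
Proof.
by rewrite /ren_sign -(perm_size (perm_thetas _)); case: thetas => [|a []].
Qed.

Lemma crossings_smon_ren u m1 m2 : {mono u : x y / (x < y)%N} ->
  crossings (smon_ren u m1).1 (smon_ren u m2).1 = crossings m1.1 m2.1.
Proof.
move=> hu; have uI : injective u.
  by move=> x y e; have := hu x y; have := hu y x; rewrite e ltnn; lia.
by rewrite (crossings_perm (perm_imfset _ uI) (perm_imfset _ uI)) crossings_map.
Qed.

Section Lam.
Variable R : comNzRingType.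
Implicit Types f g : sseries R.

Lemma divisors_smon_ren u m : bijective u ->
  perm_eq (divisors (smon_ren u m))
          [seq (smon_ren u p.1, smon_ren u p.2) | p <- divisors m].
Proof.
move=> ub; have uI := bij_inj ub; have [v uK vK] := ub.
have rI := smon_ren_inj uI.
apply: uniq_perm; rewrite ?map_inj_uniq ?divisors_uniq //.
  by move=> [a b] [c d] e; congr pair; [exact: rI (congr1 fst e) | exact: rI (congr1 snd e)].
move=> p; apply/idP/mapP => [|[q + ->]].
- rewrite mem_divisors => /andP[d /eqP e].
  have rK x : smon_ren u (smon_ren v x) = x.
    by rewrite smon_ren_comp smon_ren_id.
  exists (smon_ren v p.1, smon_ren v p.2); last by rewrite /= !rK; case: (p).
  rewrite mem_divisors disjoint_smon_ren; last exact: can_inj vK.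
  by apply/andP; split=> //; apply/eqP/rI; rewrite smon_ren_mul !rK.
- by rewrite !mem_divisors disjoint_smon_ren // -smon_ren_mul => /andP[-> /eqP->] /=.
Qed.

Lemma Lam0 : Lam (0 : sseries R).
Proof. by split=> [|u _ m]; [exists 0%N | rewrite mulr0]. Qed.

Lemma LamD f g : Lam f -> Lam g -> Lam (f + g).
Proof.
move=> [[d bf] sf] [[e bg] sg]; split; last first.
  by move=> u ub m; rewrite [LHS]/(f _ + g _) sf // sg //; exact/esym/mulrDr.
exists (maxn d e) => m; rewrite gtn_max => /andP[/bf fm /bg gm].
by rewrite [LHS]/(f m + g m) fm gm; exact: addr0.
Qed.

Lemma LamZ c f : Lam f -> Lam (c *: f).
Proof.
move=> [[d bf] sf]; split; last first.
  by move=> u ub m; rewrite [LHS]/(c * f _) sf //; exact: mulrCA.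
by exists d => m /bf fm; rewrite [LHS]/(c * f _) fm; exact: mulr0.
Qed.

Lemma Lam_sum (I : Type) (r : seq I) (F : I -> sseries R) :
  (forall i, Lam (F i)) -> Lam (\sum_(i <- r) F i).
Proof. by move=> h; elim/big_ind: _; [exact: Lam0 | exact: LamD | ]. Qed.

Lemma Lam_one : Lam (@sone R).
Proof.
split; first by exists 0%N => m; rewrite /sone; case: (m =P smon_one) => // ->;
  rewrite /smon_deg cardfs0 /= enum_mset0.
move=> u /bij_inj uI m; rewrite /sone -{1}(smon_ren_one u) (inj_eq (smon_ren_inj uI)).
by case: (m =P smon_one) => [->|_]; rewrite ?mulr0 // ren_sign_small ?mulr1 // cardfs0.
Qed.

Lemma Lam_mul f g : Lam f -> Lam g -> Lam (smul f g).
Proof.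
move=> [[a bf] sf] [[b bg] sg]; split.
  exists (a + b)%N => m abm; rewrite /smul smultE big_seq big1 // => p.
  rewrite mem_divisors => /andP[d /eqP e].
  have : (a < smon_deg p.1)%N \/ (b < smon_deg p.2)%N.
    apply/orP; rewrite !ltnNge -negb_and; apply: contraTN abm => /andP[h1 h2].
    rewrite -leqNgt -e /smon_deg /= cardfsU (disjoint_fsetI0 d) cardfs0 subn0 size_msetD.
    by rewrite addnACA leq_add.
  by rewrite /tens => -[/bf|/bg] ->; rewrite ?mul0r ?mulr0.
move=> u ub m; have uI := bij_inj ub.
rewrite /smul !smultE (perm_big _ (divisors_smon_ren m ub)) big_map mulr_sumr !big_seq.
apply: eq_bigr => p; rewrite mem_divisors => /andP[d /eqP <-].
rewrite /tens sf // sg // [_ (ren_sign u (smon_mul _ _))](signr_parity _ (ren_sign_mul uI d)).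
(* The crossings of [p] before renaming enter twice, from [smult] and from [ren_sign_mul]; [h] says
   that the square of this sign is 1. *)
rewrite !exprD; have := signrMK (crossings p.1.1 p.2.1) (1 : R); rewrite mulr1 => h.
by ring: h.
Qed.

End Lam.

(** * The coproduct of a product *)

(** The monomial at which [coprod] reads its argument. Parity of the indices makes this a bijection
    from pairs of monomials to monomials. *)
Definition interleave (p : smon * smon) : smon :=
  smon_mul (smon_ren (fun i => i.*2) p.1) (smon_ren (fun i => i.*2.+1) p.2).

Lemma doubleI : injective (fun i => i.*2).
Proof. exact: double_inj. Qed.

Lemma doubleSI : injective (fun i => i.*2.+1).
Proof. by move=> i j [] /double_inj. Qed.

Lemma double_mono : {mono (fun i => i.*2) : x y / (x < y)%N}.
Proof. by move=> i j; rewrite ltn_double. Qed.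

Lemma doubleS_mono : {mono (fun i => i.*2.+1) : x y / (x < y)%N}.
Proof. by move=> i j; rewrite ltnS ltn_double. Qed.

Lemma disjoint_even_odd m1 m2 :
  [disjoint (smon_ren (fun i => i.*2) m1).1 & (smon_ren (fun i => i.*2.+1) m2).1]%fset.
Proof.
apply/fdisjointP => _ /imfsetP[i _ ->]; apply/imfsetP => -[j _] /=; lia.
Qed.

Lemma interleave_fst p x : (x \in (interleave p).1) = (x./2 \in (if odd x then p.2 else p.1).1).
Proof.
rewrite /= inE; apply/orP/idP.
  by move=> [] /imfsetP[i im ->]; rewrite /= odd_double ?uphalf_double ?doubleK.
move=> h; have e := odd_double_half x; move: h e; case: (odd x) => /= h e; [right|left];
  by apply/imfsetP; exists x./2 => //=; rewrite -[LHS]e.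
Qed.

Lemma interleave_snd p x : (interleave p).2 x = (if odd x then p.2 else p.1).2 x./2.
Proof.
rewrite [LHS]msetE2 !smon_renE -count_mem_mset; case: ifP => ox.
  rewrite [X in (X + _)%N](eq_count (a2 := pred0)); last by move=> i /=; lia.
  by rewrite count_pred0; apply: eq_count => i /=; lia.
rewrite [X in (_ + X)%N](eq_count (a2 := pred0)); last by move=> i /=; lia.
by rewrite count_pred0 addn0; apply: eq_count => i /=; lia.
Qed.

Lemma interleave_inj : injective interleave.
Proof.
move=> [m1 m2] [n1 n2] e; congr pair; apply: smonP => x.
- by have := interleave_fst (m1, m2) x.*2; rewrite e interleave_fst odd_double doubleK.
- by have := interleave_snd (m1, m2) x.*2; rewrite e interleave_snd odd_double doubleK.
- have := interleave_fst (m1, m2) x.*2.+1.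
  by rewrite e interleave_fst /= odd_double /= uphalf_double.
- have := interleave_snd (m1, m2) x.*2.+1.
  by rewrite e interleave_snd /= odd_double /= uphalf_double.
Qed.

Lemma interleave_surj m : exists p, interleave p = m.
Proof.
(* [h b] keeps the variables whose index has parity [b] and halves the indices. *)
pose h (b : bool) : smon := ([fset i./2 | i in m.1 & odd i == b]%fset,
  seq_mset [seq i./2 | i <- m.2 & odd i == b]).
have h1 b i : (i \in (h b).1) = (i.*2 + b \in m.1)%N.
  apply/imfsetP/idP => [[j + ->]|im].
    by rewrite !inE => /andP[jm /eqP <-]; rewrite addnC odd_double_half.
  by exists (i.*2 + b)%N; rewrite ?inE /= ?im ?oddD ?odd_double /=; case: (b) => //; lia.
have h2 b i : (h b).2 i = m.2 (i.*2 + b)%N.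
  rewrite /h /= mset_seqE count_map count_filter -[RHS]count_mem_mset.
  by apply: eq_count => j /=; case: (b); lia.
exists (h false, h true); apply: smonP => x.
  rewrite interleave_fst /=; rewrite -[in RHS](odd_double_half x) addnC.
  by case: odd; rewrite h1.
rewrite interleave_snd /=; rewrite -[in RHS](odd_double_half x) addnC.
by case: odd; rewrite h2.
Qed.

Lemma interleave_mul p q :
  interleave (smon_mul p.1 q.1, smon_mul p.2 q.2) = smon_mul (interleave p) (interleave q).
Proof. by rewrite /interleave !smon_ren_mul /smon_mul /= fsetUACA msetDACA. Qed.

Lemma disjoint_interleave p q :
  [disjoint (interleave p).1 & (interleave q).1]%fset =
  [disjoint p.1.1 & q.1.1]%fset && [disjoint p.2.1 & q.2.1]%fset.
Proof.
have h m1 m2 : (smon_mul m1 m2).1 = (m1.1 `|` m2.1)%fset by [].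
rewrite /interleave !h fdisjointUX !fdisjointXU !(disjoint_smon_ren, disjoint_even_odd);
  [|exact: doubleSI|exact: doubleI].
by rewrite (fdisjoint_sym (smon_ren _ p.2).1) disjoint_even_odd andbT.
Qed.

(** Even and odd variables never meet, so an interleaved monomial factors componentwise; the
    multiplicativity of the coproduct rests on this reindexing. *)
Lemma divisors_interleave m :
  perm_eq (divisors (interleave m))
    [seq (interleave (x.1, y.1), interleave (x.2, y.2)) | x <- divisors m.1, y <- divisors m.2].
Proof.
apply: uniq_perm; first exact: divisors_uniq.
- apply: allpairs_uniq; rewrite ?divisors_uniq //.
  move=> [[x1 x2] [y1 y2]] [[z1 z2] [t1 t2]] _ _ /= e.
  have [-> ->] := interleave_inj (congr1 fst e).
  by have [-> ->] := interleave_inj (congr1 snd e).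
move=> z; apply/idP/allpairsP => [|[[x y] [+ + ->]]].
- have [p pz] := interleave_surj z.1; have [q qz] := interleave_surj z.2.
  rewrite mem_divisors -pz -qz disjoint_interleave -interleave_mul.
  move=> /andP[/andP[d1 d2] /eqP/interleave_inj e].
  exists ((p.1, q.1), (p.2, q.2)); rewrite !mem_divisors d1 d2 -e /= !eqxx.
  by split=> //; case: z pz qz => z1 z2 /= <- <-; case: (p); case: (q).
- rewrite !mem_divisors disjoint_interleave /= => /andP[-> /eqP e1] /andP[-> /eqP e2].
  by rewrite -(interleave_mul (x.1, y.1) (x.2, y.2)) /= e1 e2 -surjective_pairing.
Qed.

Section Coproduct.
Variable R : comNzRingType.
Implicit Types (f g : sseries R) (F G : sseries2 R).

Lemma coprodE f p : coprod f p =
  (-1) ^+ crossings (smon_ren (fun i => i.*2) p.1).1 (smon_ren (fun i => i.*2.+1) p.2).1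
  * f (interleave p).
Proof. by rewrite /coprod smon_signE. Qed.

(* The product of the superalgebra [Lam (x) Lam], where
   [(a (x) b) (c (x) d) = (-1)^(|b| |c|) a c (x) b d]. *)
Definition smul2 F G : sseries2 R := fun m =>
  \sum_(x <- divisors m.1) \sum_(y <- divisors m.2)
    (-1) ^+ (crossings x.1.1 x.2.1 + crossings y.1.1 y.2.1 + #|` y.1.1| * #|` x.2.1|)
    * (F (x.1, y.1) * G (x.2, y.2)).

Lemma coprod_mul f g : coprod (smul f g) = smul2 (coprod f) (coprod g).
Proof.
apply/funext => m; rewrite coprodE /smul smultE (perm_big _ (divisors_interleave m)).
rewrite big_allpairs_dep mulr_sumr /smul2 !big_seq; apply: eq_bigr => x xm.
rewrite mulr_sumr !big_seq; apply: eq_bigr => y ym.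
move: xm ym; rewrite !mem_divisors => /andP[dx /eqP ex] /andP[dy /eqP ey].
rewrite /tens !coprodE -ex -ey !smon_ren_mul /=.
set a := imfset _ _ (mem x.1.1); set c := imfset _ _ (mem x.2.1).
set b := imfset _ _ (mem y.1.1); set e := imfset _ _ (mem y.2.1).
have dac : [disjoint a & c]%fset by rewrite -(disjoint_smon_ren _ _ doubleI) in dx.
have dbe : [disjoint b & e]%fset by rewrite -(disjoint_smon_ren _ _ doubleSI) in dy.
have dab : [disjoint a & b]%fset by exact: (disjoint_even_odd x.1 y.1).
have dce : [disjoint c & e]%fset by exact: (disjoint_even_odd x.2 y.2).
have dcb : [disjoint c & b]%fset by exact: (disjoint_even_odd x.2 y.1).
have cx : crossings x.1.1 x.2.1 = crossings a c by rewrite -(crossings_smon_ren _ _ double_mono).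
have cy : crossings y.1.1 y.2.1 = crossings b e by rewrite -(crossings_smon_ren _ _ doubleS_mono).
have -> : #|` y.1.1| = #|` b| by rewrite -(card_smon_ren _ doubleSI).
have -> : #|` x.2.1| = #|` c| by rewrite -(card_smon_ren _ doubleI).
rewrite cx cy mulnC -crossings_symU // !crossingsUl // !crossingsUr //.
set u := f _; set v := g _.
(* [crossings a e] occurs once in the sign of the coproduct and once in that of the product, hence
   cancels; [crossings c b + crossings b c] is the exponent $|b||c|$ in [smul2]. *)
transitivity ((-1) ^+ (crossings a b + crossings c e + crossings a c + crossings b e +
  (crossings c b + crossings b c)) * (u * v)).
  rewrite mulrA -exprD; congr (_ * _); apply: signr_parity; rewrite !oddD.
  by do 7!case: (odd _).
by rewrite !exprD; ring.
Qed.
End Coproduct.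

(** * The antipode on products of power sums *)

(** One family serves both kinds of power sums, [b] being the fermionic degree. The condition
    [b || (0 < k)] used below excludes $p_0$, all of whose terms would be the monomial 1. *)
Definition pow_mon (b : bool) (k i : nat) : smon :=
  (if b then [fset i]%fset else fset0, msetn k i).

Lemma card_pow_mon b k i : #|` (pow_mon b k i).1| = b.
Proof. by case: b; rewrite /= ?cardfs1 ?cardfs0. Qed.

Lemma size_pow_mon b k i : size (pow_mon b k i).2 = k.
Proof. by rewrite enum_msetn size_nseq. Qed.

Lemma pow_mon_inj b k : b || (0 < k)%N -> injective (pow_mon b k).
Proof.
move=> bk i j e; move: (congr1 fst e) (congr1 snd e) bk => /=.
by case: (b) => [/fset1_inj//|_ /msetn_inj h /h].
Qed.

Lemma smon_ren_pow_mon u b k i : injective u ->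
  smon_ren u (pow_mon b k i) = pow_mon b k (u i).
Proof.
move=> uI; apply: smonP => [x|j].
  by case: b; rewrite /= ?imfset_fset1 ?imfset0.
rewrite smon_renE [RHS]msetnE enum_msetn count_nseq /= eq_sym.
by case: eqP => _; rewrite ?mul1n ?mul0n.
Qed.

Lemma pow_mon_neq1 b k i : b || (0 < k)%N -> (pow_mon b k i == smon_one) = false.
Proof.
move=> bk; apply/eqP => e; have := card_pow_mon b k i; have := size_pow_mon b k i.
by rewrite e cardfs0 /= enum_mset0 /= => k0 b0; move: bk; rewrite -k0; case: b b0 {e}.
Qed.

Section Powers.
Variable R : comNzRingType.

(* [p_k] if [b = false], [\tilde p_k] if [b = true]. *)
Definition pow_sum (b : bool) (k : nat) : sseries R :=
  fun m => \sum_(i \in [set: nat]) ((m == pow_mon b k i)%:R : R).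

Lemma pow_sumE b k m : b || (0 < k)%N ->
  pow_sum b k m = (`[< exists i, m = pow_mon b k i >])%:R.
Proof.
move=> bk; case: asboolP => [[i ->]|h]; last first.
  by apply: fsbig1 => i _; case: eqP => // e; case: h; exists i.
rewrite /pow_sum (fsbigE [:: i]) //; first by rewrite big_mkcond big_seq1 in_setT eqxx.
by move=> j _; rewrite inE (inj_eq (pow_mon_inj bk)) eq_sym => /negPf ->.
Qed.

Lemma pow_sum_neq0 b k m : pow_sum b k m != 0 -> exists i, m = pow_mon b k i.
Proof.
apply: contra_neqP => h; apply: fsbig1 => i _.
by case: eqP => // e; case: h; exists i.
Qed.

Lemma fermionic_pow_sum (b : bool) k : fermionic b (pow_sum b k).
Proof. by move=> m /pow_sum_neq0[i ->]; exact: card_pow_mon. Qed.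

Lemma Lam_pow_sum b k : Lam (pow_sum b k).
Proof.
split.
  exists (b + k)%N => m; apply: contraTeq => /pow_sum_neq0[i ->].
  by rewrite /smon_deg card_pow_mon size_pow_mon ltnn.
move=> u ub m; have uI := bij_inj ub.
have -> : pow_sum b k (smon_ren u m) = pow_sum b k m.
  rewrite /pow_sum (reindex_fsbigT u _ ub); apply: eq_fsbigr => i _.
  by rewrite -smon_ren_pow_mon // (inj_eq (smon_ren_inj uI)).
have [->|/fermionic_pow_sum mb] := eqVneq (pow_sum b k m) 0; first by rewrite mulr0.
by rewrite ren_sign_small ?mul1r // mb; case: (b).
Qed.

Lemma interleave_pow_mon b k i :
  interleave (pow_mon b k i, smon_one) = pow_mon b k i.*2 /\
  interleave (smon_one, pow_mon b k i) = pow_mon b k i.*2.+1.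
Proof.
rewrite /interleave !smon_ren_one !smon_ren_pow_mon ?smon_mul1; last 2 first.
- exact: doubleSI.
- exact: doubleI.
by rewrite smon_mulC smon_mul1.
Qed.

(** Each term involves a single variable, whose index is even (first alphabet) or odd (second
    alphabet). *)
Lemma coprod_pow_sum b k : b || (0 < k)%N ->
  coprod (pow_sum b k) = tens (pow_sum b k) (@sone R) + tens (@sone R) (pow_sum b k).
Proof.
move=> bk; apply/funext => -[m1 m2].
transitivity ((pow_sum b k m1 : R) * (sone R m2 : R) +
  (sone R m1 : R) * (pow_sum b k m2 : R)); last by [].
rewrite coprodE.
have e1 i := (interleave_pow_mon b k i).1; have e2 i := (interleave_pow_mon b k i).2.
rewrite !pow_sumE // /sone; case: asboolP => [[i ei]|h].
  have [j [[-> ->]|[-> ->]]] : exists j, (m1, m2) = (pow_mon b k j, smon_one) \/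
      (m1, m2) = (smon_one, pow_mon b k j).
    exists i./2; move: ei; rewrite -{1}(odd_double_half i); case: odd => /=.
      by rewrite add1n -e2 => /interleave_inj; right.
    by rewrite add0n -e1 => /interleave_inj; left.
  - rewrite smon_ren_one crossingss0 eqxx pow_mon_neq1 // mul0r addr0.
    by case: asboolP => [_|[]]; [rewrite !mul1r | exists j].
  - rewrite smon_ren_one crossings0s eqxx pow_mon_neq1 // mulr0 add0r.
    by case: asboolP => [_|[]]; [rewrite !mul1r | exists j].
rewrite mulr0; case: asboolP => [[i e]|_].
  case: eqP => [e'|_]; first by case: h; exists i.*2; rewrite -e1 e e'.
  case: eqP => [e'|_]; last by rewrite mulr0 mul0r addr0.
  by move: (pow_mon_neq1 i bk); rewrite -e e' eqxx.
rewrite mul0r add0r; case: eqP => [e|_]; last by rewrite mul0r.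
case: asboolP => [[i e']|_]; last by rewrite mulr0.
by case: h; exists i.*2.+1; rewrite -e2 e e'.
Qed.

Definition pow_word (w : seq (bool * nat)) : sseries R :=
  \big[@smul R/@sone R]_(x <- w) pow_sum x.1 x.2.

Definition word_valid (w : seq (bool * nat)) : bool := all (fun x => x.1 || (0 < x.2)%N) w.

Definition word_fdeg (w : seq (bool * nat)) : nat := count fst w.

Lemma pow_word_cons x w : pow_word (x :: w) = smul (pow_sum x.1 x.2) (pow_word w).
Proof. exact: big_cons. Qed.

Lemma pow_word_nil : pow_word [::] = @sone R.
Proof. exact: big_nil. Qed.

Lemma fermionic_pow_word w : fermionic (word_fdeg w) (pow_word w).
Proof.
elim: w => [|x w IH]; first by rewrite pow_word_nil; exact: fermionic_one.
rewrite pow_word_cons; apply: fermionic_mul IH; exact: fermionic_pow_sum.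
Qed.

Lemma Lam_pow_word w : Lam (pow_word w).
Proof.
elim: w => [|x w IH]; first by rewrite pow_word_nil; exact: Lam_one.
by rewrite pow_word_cons; apply: Lam_mul IH; exact: Lam_pow_sum.
Qed.

Lemma pow_word_cat v w : pow_word (v ++ w) = smul (pow_word v) (pow_word w).
Proof.
elim: v => [|x v IH]; first by rewrite pow_word_nil smul1.
by rewrite /= !pow_word_cons IH smulA.
Qed.

(* The terms of [Delta (p_w)], each with the exponent of its sign. *)
Fixpoint word_splits (w : seq (bool * nat)) : seq (nat * (seq (bool * nat) * seq (bool * nat))) :=
  if w is x :: w' then
    [seq (t.1, (x :: t.2.1, t.2.2)) | t <- word_splits w'] ++
    [seq (t.1 + x.1 * word_fdeg t.2.1, (t.2.1, x :: t.2.2))%N | t <- word_splits w']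
  else [:: (0%N, ([::], [::]))].

(** The split [(w, [::])] carries the unknown value of [S] in the antipode axiom; in all others the
    left factor is shorter, within reach of an induction on length. *)
Lemma word_splits_head w : word_valid w ->
  exists2 s, word_splits w = (0%N, (w, [::])) :: s &
    {in s, forall t, (size t.2.1 < size w)%N && word_valid t.2.1}.
Proof.
elim: w => [|x w IH] /=; first by exists [::].
move=> /andP[vx vw]; have [s -> sP] := IH vw; rewrite /=; eexists; first by [].
move=> t; rewrite mem_cat inE.
move=> /orP[/mapP[y /sP/andP[h1 h2] ->]|/orP[/eqP->|/mapP[y /sP/andP[h1 h2] ->]]] //=.
- by rewrite ltnS h1 vx h2.
- by rewrite ltnSn vw.
- by rewrite ltnS (ltnW h1) h2.
Qed.


(** The letter [x] goes left or right, and the two choices have opposite signs. *)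
Lemma sum_word_splits x w :
  \sum_(t <- word_splits (x :: w)) (-1) ^+ size t.2.1 = 0 :> R.
Proof.
rewrite /= big_cat !big_map /=.
under eq_bigr do rewrite exprS mulN1r.
by rewrite sumrN addNr.
Qed.

End Powers.

Section Linearity.
Variable R : comNzRingType.
Implicit Types (f g : sseries R) (F G : sseries2 R).

Lemma lincombE (T I : Type) (r : seq I) (c : I -> R) (F : I -> T -> R^o) (x : T) :
  (\sum_(i <- r) c i *: F i) x = \sum_(i <- r) c i * F i x :> R.
Proof. by elim/big_rec2: _ => // i y z _ <-. Qed.

Lemma smult_lincomb I (r : seq I) (c : I -> R) (F : I -> sseries2 R) :
  smult (\sum_(i <- r) c i *: F i) = \sum_(i <- r) c i *: smult (F i).
Proof.
apply/funext => m; rewrite lincombE smultE.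
transitivity (\sum_(p <- divisors m) \sum_(i <- r)
    c i * ((-1) ^+ crossings p.1.1 p.2.1 * F i p)).
  apply: eq_bigr => p _; rewrite lincombE mulr_sumr.
  by apply: eq_bigr => i _; rewrite mulrCA.
rewrite exchange_big; apply: eq_bigr => i _.
by rewrite smultE mulr_sumr.
Qed.

Lemma smulZl c f g : smul (c *: f) g = c *: smul f g.
Proof.
have -> : smul (c *: f) g = smult (\sum_(i <- [:: tt]) c *: tens f g).
  rewrite big_seq1 /smul; congr smult; apply/funext => p; exact/esym/mulrA.
by rewrite smult_lincomb big_seq1.
Qed.

Lemma smulZr c f g : smul f (c *: g) = c *: smul f g.
Proof.
have -> : smul f (c *: g) = smult (\sum_(i <- [:: tt]) c *: tens f g).
  rewrite big_seq1 /smul; congr smult; apply/funext => p; exact: mulrCA.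
by rewrite smult_lincomb big_seq1.
Qed.

Lemma smul2_tens a b f1 f2 g1 g2 : fermionic a f2 -> fermionic b g1 ->
  smul2 (tens f1 f2) (tens g1 g2) = (-1) ^+ (a * b) *: tens (smul f1 g1) (smul f2 g2).
Proof.
move=> ha hb; apply/funext => m.
transitivity ((-1) ^+ (a * b) * ((smul f1 g1 m.1 : R) * (smul f2 g2 m.2 : R))); last by [].
rewrite /smul !smultE /smul2 mulr_suml mulr_sumr; apply: eq_bigr => x _.
rewrite !mulr_sumr; apply: eq_bigr => y _; rewrite /tens /=.
have [->|/ha <-] := eqVneq (f2 y.1) 0; first by rewrite !(mulr0, mul0r).
have [->|/hb <-] := eqVneq (g1 x.2) 0; first by rewrite !(mulr0, mul0r).
by rewrite !exprD; ring.
Qed.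

Lemma smul2_lincombl F1 F2 I (r : seq I) (c : I -> R) (G : I -> sseries2 R) :
  smul2 (F1 + F2) (\sum_(i <- r) c i *: G i) =
  \sum_(i <- r) c i *: smul2 F1 (G i) + \sum_(i <- r) c i *: smul2 F2 (G i).
Proof.
apply/funext => m.
transitivity (\sum_(i <- r) c i * (smul2 F1 (G i) m : R) +
  \sum_(i <- r) c i * (smul2 F2 (G i) m : R)); last first.
  by rewrite -(lincombE r c (fun i => smul2 F1 (G i))) -(lincombE r c (fun i => smul2 F2 (G i))).
rewrite -big_split /smul2 /=.
under [RHS]eq_bigr do rewrite -mulrDr -big_split mulr_sumr.
rewrite [RHS]exchange_big; apply: eq_bigr => x _.
under [RHS]eq_bigr do rewrite -big_split mulr_sumr.
rewrite [RHS]exchange_big; apply: eq_bigr => y _ /=.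
rewrite lincombE !mulr_sumr; apply: eq_bigr => i _.
set e := (-1) ^+ _; have -> : (F1 + F2) (x.1, y.1) = (F1 (x.1, y.1) : R) + F2 (x.1, y.1) by [].
by ring.
Qed.

Lemma coprod_one : coprod (@sone R) = tens (@sone R) (@sone R).
Proof.
apply/funext => -[m1 m2]; rewrite coprodE /tens /sone.
have -> : smon_one = interleave (smon_one, smon_one).
  by rewrite /interleave !smon_ren_one smon_mul1.
rewrite (inj_eq interleave_inj) xpair_eqE.
rewrite /interleave !smon_ren_one smon_mul1.
case: eqP => [->|_]; last by rewrite mulr0 mul0r.
by rewrite smon_ren_one crossings0s mul1r.
Qed.

Lemma coprod_pow_word w : word_valid w ->
  coprod (pow_word R w) = \sum_(t <- word_splits w)
    (-1) ^+ t.1 *: tens (pow_word R t.2.1) (pow_word R t.2.2).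
Proof.
elim: w => [|x w IH] /=.
  by rewrite big_seq1 expr0 scale1r pow_word_nil coprod_one.
move=> /andP[vx /IH e]; rewrite pow_word_cons coprod_mul coprod_pow_sum // e.
rewrite smul2_lincombl big_cat !big_map; congr (_ + _); apply: eq_bigr => t _.
  rewrite (smul2_tens (a := 0) _ _ (@fermionic_one R) (@fermionic_pow_word R _)).
  by rewrite mul0n expr0 scale1r smul1 pow_word_cons.
rewrite (smul2_tens _ _ (@fermionic_pow_sum R _ _) (@fermionic_pow_word R _)).
by rewrite smul1 pow_word_cons scalerA -exprD.
Qed.

(** A letter sent to the right has passed the left factor and acquired a sign; multiplying back
    moves it past the same factor, and the two signs cancel. *)
Lemma smul_word_splits w t : t \in word_splits w ->
  (-1) ^+ t.1 *: smul (pow_word R t.2.1) (pow_word R t.2.2) = pow_word R w.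
Proof.
elim: w t => [|x w IH] t /=.
  by rewrite inE => /eqP -> /=; rewrite expr0 scale1r pow_word_nil smul1.
rewrite mem_cat => /orP[] /mapP[y /IH e ->] /=; rewrite !pow_word_cons -e.
  by rewrite smulZr smulA.
rewrite smulZr !smulA (smulC (@fermionic_pow_sum R _ _) (@fermionic_pow_word R y.2.1)).
by rewrite smulZl scalerA exprD.
Qed.

Lemma linear_on_LamE S I (r : seq I) (c : I -> R) (f : I -> sseries R) :
  linear_on_Lam S -> (forall i, Lam (f i)) ->
  S (\sum_(i <- r) c i *: f i) = \sum_(i <- r) c i *: S (f i).
Proof.
case=> _ SD SZ Lf; elim: r => [|i r IH].
  rewrite !big_nil; have := SZ 0 0 (Lam0 R); by rewrite !scale0r.
rewrite !big_cons SD ?SZ ?IH //; first exact: LamZ.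
by apply: Lam_sum => j; apply: LamZ.
Qed.

Lemma counit_pow_word w : word_valid w -> counit (pow_word R w) = (w == [::])%:R.
Proof.
case: w => [|x w] /=; first by rewrite pow_word_nil /counit /sone eqxx.
move=> /andP[vx _]; rewrite pow_word_cons /counit /smul smultE big_seq big1 // => p.
rewrite mem_divisors => /andP[_ /eqP e]; rewrite /tens.
have [->|/pow_sum_neq0[i pi]] := eqVneq (pow_sum R x.1 x.2 p.1) 0.
  by rewrite mul0r mulr0.
exfalso; have := pow_mon_neq1 i vx; rewrite -pi => /eqP; apply; apply: smonP => y.
  by apply: contraFF (in_fset0 y) => yp; rewrite -[fset0]/smon_one.1 -e inE yp.
by apply/eqP; rewrite mset0E -leqn0 -[leqRHS](mset0E y) -[mset0]/smon_one.2 -e msetE2 leq_addr.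
Qed.

Lemma antipode_pow_word S w : is_antipode S -> word_valid w ->
  S (pow_word R w) = (-1) ^+ size w *: pow_word R w.
Proof.
move=> [SL SA _]; have [n] := ubnP (size w); elim: n w => // n IH w; rewrite ltnS => wn vw.
have := SA _ (Lam_pow_word R w); rewrite counit_pow_word // coprod_pow_word //.
have [s sE sP] := word_splits_head vw.
have -> : tens_l S (\sum_(t <- word_splits w)
    (-1) ^+ t.1 *: tens (pow_word R t.2.1) (pow_word R t.2.2)) =
  \sum_(t <- word_splits w) (-1) ^+ t.1 *: tens (S (pow_word R t.2.1)) (pow_word R t.2.2).
  apply/funext => p; rewrite lincombE /tens_l.
  (* For fixed [p.2] the argument of [S] is a finite combination of words with scalar coefficients,
     to which linearity applies. *)
  have -> : (fun m => (\sum_(t <- word_splits w) (-1) ^+ t.1 *: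
       tens (pow_word R t.2.1) (pow_word R t.2.2)) (m, p.2)) =
    \sum_(t <- word_splits w) ((-1) ^+ t.1 * pow_word R t.2.2 p.2) *: pow_word R t.2.1.
    apply/funext => m; rewrite !lincombE; apply: eq_bigr => t _.
    by rewrite /tens /= -mulrA [_ * pow_word R _ m]mulrC.
  rewrite linear_on_LamE //; last by move=> t; exact: Lam_pow_word.
  rewrite lincombE; apply: eq_bigr => t _.
  by rewrite /tens /= -mulrA [_ * S _ _]mulrC.
rewrite smult_lincomb sE big_cons /= expr0 scale1r pow_word_nil.
rewrite -[smult (tens _ _)]/(smul _ _) smulr1.
rewrite [X in _ + X = _](_ : _ = (\sum_(t <- s) (-1) ^+ size t.2.1) *: pow_word R w); last first.
  rewrite scaler_suml !big_seq; apply: eq_bigr => t ts.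
  have /andP[tw tv] := sP _ ts; rewrite IH //; last exact: leq_trans tw wn.
  rewrite -[smult (tens _ _)]/(smul _ _) smulZl scalerA mulrC -scalerA (@smul_word_splits w) //.
  by rewrite sE inE ts orbT.
(* For the empty word [s] is empty. Otherwise the counit vanishes and, by [sum_word_splits], the
   signs over [s] add up to the opposite of the sign of the full word. *)
case: w wn vw sE sP => [|x w] wn vw sE sP.
  by case: sE => <-; rewrite big_nil scale0r addr0 eqxx expr0 !scale1r pow_word_nil.
have := sum_word_splits R x w; rewrite sE big_cons => /eqP.
by rewrite addrC addr_eq0 => /eqP -> /eqP; rewrite scaleNr [_ == [::]]/= scale0r subr_eq0 => /eqP ->.
Qed.

End Linearity.

(** * Terms of monomial functions *)

Definition exponents (v c : seq nat) : {mset nat} :=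
  seq_mset (flatten [seq nseq p.2 p.1 | p <- zip v c]).

Lemma exponentsE v c x : uniq v -> size v = size c -> exponents v c x = nth 0%N c (index x v).
Proof.
rewrite /exponents mset_seqE; elim: v c => [|y v IH] [|k c] //= /andP[yv uv] [svc].
rewrite count_cat count_nseq IH //=; case: eqP => [yx|_]; last by rewrite mul0n.
by rewrite mul1n -yx memNindex // svc nth_default // addn0.
Qed.

Lemma size_exponents v c : size v = size c -> size (exponents v c) = sumn c.
Proof.
rewrite (perm_size (perm_eq_seq_mset _)).
elim: v c => [|y v IH] [|k c] //= [svc]; by rewrite size_cat size_nseq IH.
Qed.

Lemma exponents_map v (A : {mset nat}) : uniq v -> {subset finsupp A <= v} ->
  exponents v (map A v) = A.
Proof.
move=> uv Av; apply/msetP => x; rewrite exponentsE ?size_map //.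
have [xv|xv] := boolP (x \in v); first by rewrite (nth_map 0%N) ?index_mem // nth_index.
rewrite memNindex // nth_default ?size_map //; apply/esym/eqP.
by rewrite mset_eq0 -msuppE; apply: contra xv => /Av.
Qed.

Lemma map_exponents v c : uniq v -> size v = size c -> map (exponents v c) v = c.
Proof.
move=> uv svc; apply: (@eq_from_nth _ 0%N); first by rewrite size_map.
move=> i; rewrite size_map => iv.
by rewrite (nth_map 0%N) // exponentsE // index_uniq.
Qed.

(** The monomials of $m_L$ with their signs forgotten. *)
Definition occurs (L : superpart) (m : smon) : Prop := exists v,
  [/\ uniq v, size v = size (spa L ++ sps L) & (mono_term (spa L) (sps L) v).2 = m].

Lemma mono_term_deg (a s v : seq nat) m : uniq v -> size v = size (a ++ s) ->
  (mono_term a s v).2 = m -> #|` m.1| = size a /\ size m.2 = sumn (a ++ s).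
Proof.
move=> uv sv <-; split; last exact: size_exponents.
have -> : #|` (mono_term a s v).2.1| = size (take (size a) v).
  have ut : uniq (take (size a) v) by rewrite -(cat_take_drop (size a) v) cat_uniq in uv; case/andP: uv.
  rewrite card_imfset //= undup_id //.
by rewrite size_takel // sv size_cat leq_addr.
Qed.

Lemma occurs_deg L m : occurs L m -> #|` m.1| = fdeg L /\ size m.2 = tdeg L.
Proof. by move=> [v [uv sv e]]; apply: (mono_term_deg uv sv e). Qed.

Lemma occurs_parts L m : occurs L m ->
  perm_eq (spa L) [seq m.2 x | x <- m.1] /\
  perm_eq (sps L) [seq m.2 x | x <- finsupp m.2 & x \notin m.1].
Proof.
move=> [v [uv sv <-]]; set m' := (mono_term _ _ v).2.
have m1 x : (x \in m'.1) = (x \in take (size (spa L)) v).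
  by apply/imfsetP/idP => /= [[y yv ->]//|xv]; exists x.
have e : map m'.2 v = spa L ++ sps L by exact: map_exponents.
have sz : size (take (size (spa L)) v) = size (spa L).
  by rewrite size_takel // sv size_cat leq_addr.
move: e; rewrite -{1}(cat_take_drop (size (spa L)) v) map_cat => /eqP.
rewrite eqseq_cat ?size_map // => /andP[/eqP e1 /eqP e2].
have := uv; rewrite -(cat_take_drop (size (spa L)) v) cat_uniq => /and3P[ut /hasPn td ud].
split.
  by rewrite -e1; apply/perm_map/uniq_perm; rewrite ?fset_uniq // => x; rewrite m1.
rewrite -e2; apply/perm_map/uniq_perm; rewrite ?filter_uniq ?fset_uniq //.
move=> x; rewrite mem_filter m1 msuppE in_mset; apply/idP/andP => [xd|[xt xm]].
  split; first exact: td.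
  have : m'.2 x \in sps L by rewrite -e2 map_f.
  by case: (m'.2 x) => // s0; have /and3P[_ _ /negP] := sp_valP L.
have : x \in v.
  move: xm; rewrite lt0n; apply: contraNT => xv.
  by rewrite [m'.2 x]exponentsE // memNindex // nth_default // sv.
by rewrite -{1}(cat_take_drop (size (spa L)) v) mem_cat (negPf xt).
Qed.

Lemma geq_anti : antisymmetric geq.
Proof. by move=> x y /=; rewrite andbC => /anti_leq. Qed.

Lemma superpart_perm (L M : superpart) :
  perm_eq (spa L) (spa M) -> perm_eq (sps L) (sps M) -> L = M.
Proof.
move=> pa ps; apply: val_inj; rewrite [LHS]surjective_pairing [RHS]surjective_pairing.
congr pair; apply: (sorted_eq geq_trans geq_anti) => //; try exact: sps_sorted.
- by have := spa_sorted L; rewrite gtn_sorted_uniq_geq => /andP[].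
- by have := spa_sorted M; rewrite gtn_sorted_uniq_geq => /andP[].
Qed.

Lemma occurs_inj L M m : occurs L m -> occurs M m -> L = M.
Proof.
move=> /occurs_parts[a1 s1] /occurs_parts[a2 s2].
by apply: superpart_perm; [apply: perm_trans a1 _ | apply: perm_trans s1 _]; rewrite perm_sym.
Qed.

(** Sorting the theta variables and the remaining ones by decreasing exponent gives the two
    sequences; injectivity makes the first strictly decreasing. *)
Lemma occurs_exists (m : smon) : {in m.1 &, injective m.2} -> exists L, occurs L m.
Proof.
move=> mI; pose le x y := (m.2 y <= m.2 x)%N.
have le_total : total le by move=> x y; exact: leq_total.
pose w1 := sort le m.1; pose w2 := sort le [seq x <- finsupp m.2 | x \notin m.1].
have vP : is_superpart (map m.2 w1, map m.2 w2).
  apply/and3P; split; rewrite /=.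
  - rewrite gtn_sorted_uniq_geq sorted_map (sort_sorted le_total) andbT.
    rewrite map_inj_in_uniq ?sort_uniq ?fset_uniq // => x y; rewrite !mem_sort; exact: mI.
  - by rewrite sorted_map (sort_sorted le_total).
  - apply/mapP => -[x]; rewrite mem_sort mem_filter => /andP[_].
    by rewrite msuppE in_mset => xm e; rewrite -e in xm.
exists (Superpart vP), (w1 ++ w2); split.
- rewrite cat_uniq !sort_uniq ?filter_uniq ?fset_uniq // andbT.
  by apply/hasPn => x; rewrite !mem_sort mem_filter => /andP[].
- by rewrite -map_cat size_map.
- rewrite /mono_term /spa /sps /= size_map take_size_cat // -map_cat.
  rewrite -/(exponents _ _) exponents_map.
  + apply: smonP => //= x; apply/imfsetP/idP => /= [[y yw ->]|xm].
      by rewrite mem_sort in yw.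
    by exists x; rewrite ?mem_sort.
  + rewrite cat_uniq !sort_uniq ?filter_uniq ?fset_uniq // andbT.
    by apply/hasPn => x; rewrite !mem_sort mem_filter => /andP[].
  + by move=> x xm; rewrite mem_cat !mem_sort mem_filter xm andbT; case: (x \in m.1).
Qed.

(** * Finiteness of each type, and the coefficients of elementary and complete functions *)

Definition type_set (n k : nat) : set superpart := [set L | tdeg L = n /\ fdeg L = k].

Lemma finite_bounded_seq N k : finite_set [set s : seq nat | (size s <= k)%N /\ all (geq N) s].
Proof.
elim: k => [|k IH].
  apply: (@sub_finite_set _ _ [set nil]%classic); last exact: finite_set1.
  by move=> [|x s] [].
apply: (@sub_finite_set _ _ ([set nil] `|`
    [set x :: s | x in `I_N.+1 & s in [set s : seq nat | (size s <= k)%N /\ all (geq N) s]])%classic).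
  move=> [|x s] [] /=; first by left.
  rewrite ltnS => sk /andP[xN sN]; right; exists x; first by rewrite /= ltnS.
  by exists s.
by rewrite finite_setU; split; [exact: finite_set1 | exact: finite_image2].
Qed.

Lemma finite_type n k : finite_set (type_set n k).
Proof.
pose B N : set (seq nat) := [set s : seq nat | (size s <= N)%N /\ all (geq n) s]%classic.
have fB N : finite_set (B N) by exact: finite_bounded_seq.
apply: (@sub_finite_set _ _ ((@sp_val) @^-1` (B k `*` B n))%classic).
  move=> L [Ln Lk] /=; have h : all (geq n) (spa L ++ sps L).
    by apply/allP => x /mem_leq_sumn; rewrite -/(tdeg L) Ln.
  move: h; rewrite all_cat => /andP[h1 h2]; split; split=> //=.
    by rewrite -Lk.
  (* Positive parts number at most their sum, which bounds the length of [sps L] by [n]. *)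
  have : (0%N \notin sps L) by case/and3P: (sp_valP L).
  have : (sumn (sps L) <= n)%N by rewrite -Ln /tdeg sumn_cat leq_addl.
  rewrite /sps; elim: (L.2) n {Ln h1 h2 fB B} => //= x s IH n xs.
  rewrite inE negb_or => /andP[x0 s0].
  have := IH (n - x)%N _ s0; lia.
apply: finite_preimage; last exact: finite_setX.
by move=> L M _ _; exact: val_inj.
Qed.

Lemma enum_fsetS (i : nat) : [fset i]%fset = [:: i] :> seq nat.
Proof.
by apply: perm_small_eq => //; apply: uniq_perm => // [|x]; rewrite ?fset_uniq ?inE.
Qed.

Section SmallMonomials.
Variable R : comNzRingType.

Lemma sp_mono_neq0 L m : sp_mono R L m != 0 -> occurs L m.
Proof.
apply: contra_neqP => h; apply: fsbig1 => b [v [uv sv e]].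
by case: h; exists v; rewrite e.
Qed.

Lemma fermionic_mono L : fermionic (fdeg L) (sp_mono R L).
Proof. by move=> m /sp_mono_neq0/occurs_deg[]. Qed.

(** With at most one theta nothing can be reordered, so only the sign [false] arises in [mono]. All
    generators $e$, $\tilde e$, $h$, $\tilde h$ fall under this case. *)
Lemma sp_mono_small L m : (fdeg L <= 1)%N -> sp_mono R L m = (`[< occurs L m >])%:R.
Proof.
move=> L1; have b0 v : odd (inv (take (size (spa L)) v)) = false.
  have : (size (take (size (spa L)) v) <= 1)%N by rewrite (leq_trans _ L1) // size_take_min geq_minl.
  by case: take => [|x []].
case: asboolP => h; last first.
  by apply/eqP; apply: contra_notT h; exact: sp_mono_neq0.
rewrite /sp_mono /mono.
rewrite (_ : (fun b => _) = [set false]%classic); last first.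
  apply/seteqP; split => [b [v [_ _]]|_ ->].
    by rewrite /mono_term b0 => -[<-].
  by case: h => v [uv sv e]; exists v; split => //; rewrite -e /mono_term b0.
by rewrite fsbig_set1 expr0.
Qed.

Definition squarefree (A : {mset nat}) : bool := all (fun x => A x == 1%N) (finsupp A).

Fact elem_s_superpartP r : is_superpart ([::], nseq r 1%N).
Proof.
apply/and3P; split=> //=; last by rewrite mem_nseq andbF.
by elim: r => //= -[].
Qed.

Fact elem_a_superpartP k : is_superpart ([:: 0%N], nseq k 1%N).
Proof. by have /and3P[_ h1 h2] := elem_s_superpartP k; apply/and3P. Qed.

Lemma elem_sE r A : elem_s R r (fset0, A) = (squarefree A && (size A == r))%:R.
Proof.
pose L := Superpart (elem_s_superpartP r).
rewrite (_ : elem_s R r = sp_mono R L) // sp_mono_small //; congr (_ %:R); congr nat_of_bool.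
apply/asboolP/andP => [oL|[sA /eqP Ar]].
  have [_ ->] := occurs_deg oL; have [_ pL] := occurs_parts oL.
  split; last by rewrite /tdeg /= sumn_nseq mul1n.
  apply/allP => x xA; have : A x \in sps L.
    by rewrite (perm_mem pL) map_f // mem_filter xA andbT.
  by rewrite mem_nseq => /andP[].
have [M oM] : exists M, occurs M (fset0, A) by apply: occurs_exists => x y.
have [M0 M1] := occurs_deg oM; have [_ pM] := occurs_parts oM.
rewrite (_ : L = M) //; apply: val_inj => /=.
rewrite [RHS]surjective_pairing; congr pair.
  by apply/esym/size0nil; rewrite -[size _]/(fdeg M) -M0 cardfs0.
have h : all (pred1 1%N) (sps M).
  rewrite (perm_all _ pM); apply/allP => _ /mapP[x + ->].
  by rewrite mem_filter => /andP[_ /(allP sA)].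
rewrite -/(sps M) (all_pred1P _ _ h); congr nseq; rewrite -Ar.
have -> : size A = sumn (sps M).
  by rewrite -[A]/((fset0 : {fset nat}, A).2) M1 /tdeg (size0nil (s := spa M)).
by rewrite (all_pred1P _ _ h) sumn_nseq mul1n size_nseq.
Qed.

Lemma elem_aE k i A : elem_a R k ([fset i]%fset, A) =
  ([&& squarefree A, A i == 0%N & size A == k])%:R.
Proof.
pose L := Superpart (elem_a_superpartP k).
rewrite (_ : elem_a R k = sp_mono R L) // sp_mono_small //; congr (_ %:R); congr nat_of_bool.
apply/asboolP/and3P => [oL|[sA /eqP Ai /eqP Ak]].
  have [_ ->] := occurs_deg oL; have [] := occurs_parts oL.
  rewrite enum_fsetS /= => /(perm_mem)/(_ 0%N); rewrite !inE eqxx => /esym/eqP Ai pL.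
  split; rewrite -?Ai //; last by rewrite /tdeg /= sumn_nseq mul1n.
  apply/allP => x xA; have : A x \in sps L.
    rewrite (perm_mem pL) map_f // mem_filter xA andbT inE; apply/eqP => xi.
    by move: xA; rewrite xi msuppE in_mset -Ai.
  by rewrite mem_nseq => /andP[].
have [M oM] : exists M, occurs M ([fset i]%fset, A).
  by apply: occurs_exists => x y /=; rewrite !inE => /eqP -> /eqP ->.
have [M0 M1] := occurs_deg oM; have [] := occurs_parts oM.
rewrite enum_fsetS /= Ai => /perm_small_eq => /(_ isT) aM pM.
rewrite (_ : L = M) //; apply: val_inj => /=.
rewrite [RHS]surjective_pairing; congr pair; first by rewrite -aM.
have h : all (pred1 1%N) (sps M).
  rewrite (perm_all _ pM); apply/allP => _ /mapP[x + ->].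
  by rewrite mem_filter => /andP[_ /(allP sA)].
rewrite -/(sps M) (all_pred1P _ _ h); congr nseq; rewrite -Ak.
have -> : size A = sumn (sps M).
  by rewrite -[A]/(([fset i]%fset, A).2) M1 /tdeg aM.
by rewrite (all_pred1P _ _ h) sumn_nseq mul1n size_nseq.
Qed.

Lemma sum_type_mono n d (c : superpart -> R) m : (d <= 1)%N ->
  (\sum_(L \in type_set n d) c L *: sp_mono R L) m =
  \sum_(L <- fset_set (type_set n d)) c L * (`[< occurs L m >])%:R.
Proof.
move=> d1; rewrite (fsbig_finite _ _ (finite_type n d)) lincombE !big_seq.
apply: eq_bigr => L; rewrite in_fset_set ?inE; last exact: finite_type.
by move=> [_ Ld]; rewrite sp_mono_small ?Ld.
Qed.

Lemma sum_type_occurs n d (c : superpart -> R) m L : occurs L m ->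
  \sum_(M <- fset_set (type_set n d)) c M * (`[< occurs M m >])%:R =
  if (tdeg L == n) && (fdeg L == d) then c L else 0.
Proof.
move=> oL; have h M : M != L -> c M * (`[< occurs M m >])%:R = 0.
  by case: asboolP => [/occurs_inj/(_ oL)->|]; rewrite ?eqxx ?mulr0.
case: ifP => [/andP[/eqP Ln /eqP Ld]|nL].
  rewrite (bigD1_seq L) ?fset_uniq //=; last first.
    by rewrite in_fset_set ?inE //; exact: finite_type.
  by rewrite (asboolT oL) mulr1 big1 ?addr0.
rewrite big_seq big1 // => M; rewrite in_fset_set ?inE; last exact: finite_type.
move=> [Mn Md]; apply: h; apply: contraFneq nL => <-; by rewrite Mn Md !eqxx.
Qed.

Lemma hom_sE r A : hom_s R r (fset0, A) = (size A == r)%:R.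
Proof.
have [M oM] : exists M, occurs M (fset0, A) by apply: occurs_exists => x y.
have [M0 M1] := occurs_deg oM.
have -> : hom_s R r = \sum_(L \in type_set r 0) (1 : R) *: sp_mono R L.
  by rewrite /hom_s; apply: eq_fsbigr => L _; rewrite scale1r.
rewrite sum_type_mono // (sum_type_occurs _ _ _ oM) -M0 -M1 cardfs0 eqxx andbT.
by case: eqP.
Qed.

(** The weight $\Lambda_1+1$ becomes the number of [j] with [j <= A i], which is how often
    [hom_a_newton] meets this monomial. *)
Lemma hom_aE k i A : hom_a R k ([fset i]%fset, A) = if size A == k then (A i).+1%:R else 0.
Proof.
have [M oM] : exists M, occurs M ([fset i]%fset, A).
  by apply: occurs_exists => x y /=; rewrite !inE => /eqP -> /eqP ->.
have [M0 M1] := occurs_deg oM; have [] := occurs_parts oM.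
rewrite enum_fsetS /= => /perm_small_eq => /(_ isT) aM _.
rewrite /hom_a -/(type_set k 1) sum_type_mono // (sum_type_occurs _ _ _ oM) -M0 -M1 cardfs1 andbT.
by rewrite aM.
Qed.

Lemma fermionic_elem_s r : fermionic 0 (elem_s R r).
Proof. exact: (@fermionic_mono (Superpart (elem_s_superpartP r))). Qed.

Lemma fermionic_elem_a k : fermionic 1 (elem_a R k).
Proof. exact: (@fermionic_mono (Superpart (elem_a_superpartP k))). Qed.

Lemma fermionic_sum_type n d (c : superpart -> R) :
  fermionic d (\sum_(L \in type_set n d) c L *: sp_mono R L).
Proof.
move=> m; rewrite (fsbig_finite _ _ (finite_type n d)) lincombE.
apply: contra_neq_eq => md; rewrite big_seq big1 // => L.
rewrite in_fset_set ?inE; last exact: finite_type.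
move=> [_ Ld]; have [->|/fermionic_mono mL] := eqVneq (sp_mono R L m) 0; first exact: mulr0.
by move: md; rewrite mL Ld eqxx.
Qed.

Lemma fermionic_hom_s r : fermionic 0 (hom_s R r).
Proof.
have -> : hom_s R r = \sum_(L \in type_set r 0) (1 : R) *: sp_mono R L.
  by rewrite /hom_s; apply: eq_fsbigr => L _; rewrite scale1r.
exact: fermionic_sum_type.
Qed.

Lemma fermionic_hom_a k : fermionic 1 (hom_a R k).
Proof. exact: fermionic_sum_type. Qed.

End SmallMonomials.

(** * Newton identities *)

Lemma msubset_msetn k i (A : {mset nat}) : msubset (msetn k i) A = (k <= A i)%N.
Proof.
apply/msubsetP/idP => [/(_ i)|kA x]; first by rewrite msetnxx.
by rewrite msetnE; case: eqP => [->|].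
Qed.

Lemma size_msetBn k i (A : {mset nat}) : (k <= A i)%N ->
  size (A `\` msetn k i) = (size A - k)%N.
Proof.
rewrite -msubset_msetn => /msetBDKC {2}<-; rewrite size_msetD enum_msetn size_nseq; lia.
Qed.

Lemma mset_leq_size (A : {mset nat}) i : (A i <= size A)%N.
Proof. by rewrite -count_mem_mset count_size. Qed.

(** The exponent of [i] is left free: it is the only one that dividing by a power of $x_i$
    changes. *)
Definition squarefree_off (A : {mset nat}) (i : nat) : bool :=
  all (fun x => (x == i) || (A x == 1%N)) (finsupp A).

Lemma squarefreeBn k i (A : {mset nat}) : (k <= A i)%N ->
  squarefree (A `\` msetn k i) = squarefree_off A i && (A i - k <= 1)%N.
Proof.
move=> kA; apply/allP/andP => [sA|[/allP sA Ak] x].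
  split; last first.
    have := sA i; rewrite msuppE in_mset msetE2 msetnxx; case: (A i - k)%N => // [[|n]] //.
    by move/(_ isT).
  apply/allP => x xA; case: eqP => //= xi; have := sA x.
  rewrite msuppE in_mset msetE2 msetnE; case: eqP => // _; rewrite subn0.
  by rewrite -in_mset -msuppE => /(_ xA).
rewrite msuppE in_mset msetE2 msetnE; case: eqP => [->|xi]; first lia.
rewrite subn0 => xA; have := sA x; rewrite msuppE in_mset => /(_ xA).
by case: eqP xi.
Qed.

Lemma squarefree_split A i : squarefree A = squarefree_off A i && (A i <= 1)%N.
Proof.
rewrite -[in RHS](subn0 (A i)) -squarefreeBn //; congr squarefree.
by rewrite msetn0 msetB0.
Qed.

Section Newton.
Variable R : comNzRingType.
Implicit Types g : sseries R.

(** The factor taken from $p_k$ is some $x_i^k$, and [0 < k] forces [i] into the support of [A]. *)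
Lemma smul_pow_s k g I A : (0 < k)%N -> smul (pow_sum R false k) g (I, A) =
  \sum_(i <- finsupp A | (k <= A i)%N) g (I, A `\` msetn k i) :> R.
Proof.
move=> k0; rewrite /smul smultE.
pose P (p : smon * smon) := `[< exists i, p.1 = pow_mon false k i >].
pose f i : smon * smon := (pow_mon false k i, (I, A `\` msetn k i)).
transitivity (\sum_(p <- divisors (I, A) | P p) (g p.2 : R)).
  rewrite [RHS]big_mkcond; apply: eq_bigr => p _; rewrite /tens pow_sumE // -/(P p).
  case: ifP => [/asboolP[i ei]|_]; last by rewrite mul0r mulr0.
  by rewrite ei crossings0s !mul1r.
rewrite -big_filter -[RHS]big_filter.
have pe : perm_eq [seq p <- divisors (I, A) | P p] (map f [seq i <- finsupp A | (k <= A i)%N]).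
  apply: uniq_perm; rewrite ?filter_uniq ?divisors_uniq ?map_inj_uniq ?filter_uniq ?fset_uniq //.
    by move=> i j e; exact: (@pow_mon_inj false k k0 _ _ (congr1 fst e)).
  move=> p; rewrite mem_filter mem_divisors; apply/andP/mapP.
    move=> [/asboolP[i ei] /andP[_ /eqP e]].
    have eI := congr1 fst e; have eA := congr1 snd e.
    move: eI eA; rewrite ei /= fset0U => eI eA.
    exists i; last by rewrite /f; case: p ei eI eA {e} => p1 [J B] /= -> -> <-; rewrite msetDKB.
    have kA : (k <= A i)%N by rewrite -eA msetE2 msetnxx leq_addr.
    by rewrite mem_filter kA msuppE in_mset (leq_trans k0 kA).
  move=> [i]; rewrite mem_filter => /andP[kA _] ->; split; first by apply/asboolP; exists i.
  rewrite /= fdisjoint0X /smon_mul /= fset0U msetBDKC ?eqxx //.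
  by rewrite msubset_msetn.
by rewrite (perm_big _ pe) big_map.
Qed.

(** As [g] is free of theta, $\theta_i$ must come from $\tilde p_k$, which leaves the single
    factorization [q]. *)
Lemma smul_pow_a k g i A : fermionic 0 g -> smul (pow_sum R true k) g ([fset i]%fset, A) =
  if (k <= A i)%N then g (fset0, A `\` msetn k i) else 0.
Proof.
move=> g0; rewrite /smul smultE; pose q : smon * smon := (pow_mon true k i, (fset0, A `\` msetn k i)).
have h p : p \in divisors ([fset i]%fset, A) -> p <> q ->
    (-1) ^+ crossings p.1.1 p.2.1 * tens (pow_sum R true k) g p = 0.
  rewrite mem_divisors /tens => /andP[_ /eqP e] pq.
  have [->|/g0/cardfs0_eq p20] := eqVneq (g p.2) 0; first by rewrite !mulr0.
  have [->|/pow_sum_neq0[j p1]] := eqVneq (pow_sum R true k p.1) 0; first by rewrite mul0r mulr0.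
  case: pq; have eI := congr1 fst e; have eA := congr1 snd e; move: eI eA.
  rewrite /= p1 p20 fsetU0 => /fset1_inj ji eA.
  by rewrite /q; case: p p1 p20 eA {e} => p1 [J B] /= -> -> <-; rewrite ji msetDKB.
case: ifP => kA.
  rewrite (bigD1_seq q) ?divisors_uniq //=; last first.
    by rewrite mem_divisors fdisjointX0 /smon_mul /= fsetU0 msetBDKC ?msubset_msetn ?eqxx.
  rewrite crossingss0 mul1r /tens /= pow_sumE // asboolT ?mul1r; last by exists i.
  by rewrite big_seq_cond big1 ?addr0 // => p /andP[/h hp /eqP/hp].
rewrite big_seq big1 // => p pd; apply: (h _ pd) => pq.
move: pd; rewrite mem_divisors => /andP[_ /eqP e].
by move/negP: kA; apply; rewrite -[A]/(([fset i]%fset, A).2) -e pq msetE2 msetnxx leq_addr.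
Qed.

(** Only [j = a] and [j = a - 1] survive, and they cancel unless [a = 0], when the second is
    absent. *)
Lemma alternating_sum a :
  \sum_(0 <= j < a.+1) (-1) ^+ j * (a - j <= 1)%N%:R = (a == 0)%N%:R :> R.
Proof.
case: a => [|a]; first by rewrite big_nat1 expr0 mul1r.
rewrite !big_nat_recr //= big_nat big1 ?add0r => [|j /andP[_ ja]]; last first.
  by rewrite (_ : (_ <= 1)%N = false) ?mulr0 //; lia.
by rewrite subnn subSn // subnn !mulr1 exprS mulN1r subrr.
Qed.

Lemma fermionicE k f g : fermionic k f -> fermionic k g ->
  (forall I A, #|` I| = k -> f (I, A) = g (I, A)) -> f = g.
Proof.
move=> fk gk h; apply/funext => -[I A]; have [Ik|/eqP Ik] := eqVneq #|` I| k; first exact: h.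
have [->|/fk//] := eqVneq (f (I, A)) 0.
by have [->|/gk//] := eqVneq (g (I, A)) 0.
Qed.

Lemma fermionic_lincomb k I (r : seq I) (c : I -> R) (F : I -> sseries R) :
  (forall i, fermionic k (F i)) -> fermionic k (\sum_(i <- r) c i *: F i).
Proof.
move=> h m; rewrite lincombE; apply: contra_neq_eq => mk; apply: big1 => i _.
have [->|/h mi] := eqVneq (F i m) 0; first exact: mulr0.
by rewrite mi eqxx in mk.
Qed.

Lemma fermionic_pow_mul (b : bool) k d g : fermionic d g ->
  fermionic (b + d) (smul (pow_sum R b k) g).
Proof. by move=> gd; apply: fermionic_mul gd; exact: fermionic_pow_sum. Qed.

Lemma big_nat_truncate a r (F : nat -> R) : (a <= r)%N ->
  \sum_(0 <= j < r | (j < a)%N) F j = \sum_(0 <= j < a) F j.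
Proof. by move=> ar; rewrite (big_nat_widen _ _ _ _ _ ar). Qed.

(** In the coefficient of $x^A$ each variable of [A] contributes an alternating sum over [j] that
    collapses to 1 if [A] is squarefree and to 0 otherwise; a squarefree [A] of degree [r] has [r]
    variables. *)
Lemma elem_s_newton r : r%:R *: elem_s R r =
  \sum_(0 <= j < r) (-1) ^+ j *: smul (pow_sum R false j.+1) (elem_s R (r - j.+1)).
Proof.
apply: (@fermionicE 0).
- have -> : r%:R *: elem_s R r = \sum_(i <- [:: tt]) r%:R *: elem_s R r by rewrite big_seq1.
  by apply: fermionic_lincomb => _; exact: fermionic_elem_s.
- apply: fermionic_lincomb => j; exact: (@fermionic_pow_mul false _ 0 _ (@fermionic_elem_s R _)).
move=> I A /cardfs0_eq ->.
transitivity (r%:R * (elem_s R r (fset0, A) : R)); first by [].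
rewrite elem_sE lincombE.
transitivity (\sum_(0 <= j < r) \sum_(i <- finsupp A | (j < A i)%N)
   (-1) ^+ j * (squarefree_off A i && (A i - j.+1 <= 1)%N && (size A == r))%:R : R); last first.
  rewrite big_nat [RHS]big_nat; apply: eq_bigr => j /andP[_ jr].
  rewrite smul_pow_s // mulr_sumr; apply: eq_bigr => i ji.
  rewrite elem_sE squarefreeBn // size_msetBn //; congr (_ * (_ && _)%:R).
  by have := mset_leq_size A i; lia.
case: (eqVneq (size A) r) => [Ar|_]; last first.
  rewrite andbF mulr0 big1 // => j _; rewrite big1 // => i _.
  by rewrite andbF mulr0.
rewrite andbT; under eq_bigr do rewrite big_mkcond; rewrite exchange_big /=.
transitivity (\sum_(i <- finsupp A) (squarefree A)%:R : R).
  rewrite big_const_seq count_predT iter_addr_0.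
  case: (boolP (squarefree A)) => sA; last by rewrite mulr0 mul0rn.
  rewrite mulr1 -Ar size_mset -sum1_size; congr (_ %:R); rewrite !big_seq.
  by apply: eq_bigr => i /(allP sA)/eqP.
rewrite !big_seq; apply: eq_bigr => i iA; rewrite (squarefree_split A i).
have A0 : (0 < A i)%N by rewrite -in_mset -msuppE.
rewrite -big_mkcond big_nat_truncate; last by rewrite -Ar mset_leq_size.
case: squarefree_off; last by rewrite big1 // => j _; rewrite mulr0.
case E: (A i) A0 => [//|a] _.
(* The exponent of [i] is [a + 1] here, because $p_{j+1}$ removes at least one $x_i$. *)
transitivity ((a == 0)%N%:R : R); first by case: (a).
rewrite -alternating_sum; apply: eq_bigr => j _.
by rewrite andbT subSS.
Qed.

(** Without signs the variable [i] is counted [A i] times, and these exponents add up to [r]. *)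
Lemma hom_s_newton r : r%:R *: hom_s R r =
  \sum_(0 <= j < r) (1 : R) *: smul (pow_sum R false j.+1) (hom_s R (r - j.+1)).
Proof.
apply: (@fermionicE 0).
- have -> : r%:R *: hom_s R r = \sum_(i <- [:: tt]) r%:R *: hom_s R r by rewrite big_seq1.
  by apply: fermionic_lincomb => _; exact: fermionic_hom_s.
- apply: fermionic_lincomb => j; exact: (@fermionic_pow_mul false _ 0 _ (@fermionic_hom_s R _)).
move=> I A /cardfs0_eq ->.
transitivity (r%:R * (hom_s R r (fset0, A) : R)); first by [].
rewrite hom_sE lincombE.
transitivity (\sum_(0 <= j < r) \sum_(i <- finsupp A | (j < A i)%N) (size A == r)%:R : R); last first.
  rewrite big_nat [RHS]big_nat; apply: eq_bigr => j /andP[_ jr].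
  rewrite smul_pow_s // mul1r; apply: eq_bigr => i ji.
  rewrite hom_sE size_msetBn //; congr (nat_of_bool _)%:R.
  by have := mset_leq_size A i; lia.
case: (eqVneq (size A) r) => [Ar|_]; last first.
  by rewrite mulr0 big1 // => j _; rewrite big1.
under eq_bigr do rewrite big_mkcond; rewrite exchange_big /= mulr1.
rewrite -{1}Ar size_mset natr_sum; apply: eq_bigr => i _.
rewrite -big_mkcond big_nat_truncate; last by rewrite -Ar mset_leq_size.
by rewrite sumr_const_nat subn0.
Qed.

(** The variable carrying theta is prescribed, so there is no sum over variables and no factor [k];
    [alternating_sum] yields the required exponent 0 of $x_i$. *)
Lemma elem_a_newton k : elem_a R k =
  \sum_(0 <= j < k.+1) (-1) ^+ j *: smul (pow_sum R true j) (elem_s R (k - j)).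
Proof.
apply: (@fermionicE 1); first exact: fermionic_elem_a.
  apply: fermionic_lincomb => j; exact: (@fermionic_pow_mul true _ 0 _ (@fermionic_elem_s R _)).
move=> I A /eqP/cardfs1P[i ->]; rewrite elem_aE lincombE.
transitivity (\sum_(0 <= j < k.+1 | (j < (A i).+1)%N)
   (-1) ^+ j * (squarefree_off A i && (A i - j <= 1)%N && (size A == k))%:R : R); last first.
  rewrite big_mkcond big_nat [RHS]big_nat; apply: eq_bigr => j /andP[_ jk].
  rewrite smul_pow_a; last exact: fermionic_elem_s.
  rewrite ltnS; case: ifP => ji; last by rewrite mulr0.
  rewrite elem_sE squarefreeBn // size_msetBn //; congr (_ * (_ && _)%:R).
  by have := mset_leq_size A i; lia.
case: (eqVneq (size A) k) => [Ak|_]; last first.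
  by rewrite !andbF big1 // => j _; rewrite andbF mulr0.
rewrite big_nat_truncate; last by rewrite -Ak ltnS mset_leq_size.
rewrite (squarefree_split A i) andbT; case: squarefree_off; last first.
  by rewrite big1 // => j _; rewrite mulr0.
transitivity ((A i == 0)%N%:R : R); first by case: (A i) => [|[]].
by rewrite -alternating_sum; apply: eq_bigr => j _; rewrite andbT.
Qed.

Lemma hom_a_newton k : hom_a R k =
  \sum_(0 <= j < k.+1) (1 : R) *: smul (pow_sum R true j) (hom_s R (k - j)).
Proof.
apply: (@fermionicE 1); first exact: fermionic_hom_a.
  apply: fermionic_lincomb => j; exact: (@fermionic_pow_mul true _ 0 _ (@fermionic_hom_s R _)).
move=> I A /eqP/cardfs1P[i ->]; rewrite hom_aE lincombE.
transitivity (\sum_(0 <= j < k.+1 | (j < (A i).+1)%N) (size A == k)%:R : R); last first.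
  rewrite big_mkcond big_nat [RHS]big_nat; apply: eq_bigr => j /andP[_ jk].
  rewrite smul_pow_a; last exact: fermionic_hom_s.
  rewrite ltnS mul1r; case: ifP => ji //.
  rewrite hom_sE size_msetBn //; congr (nat_of_bool _)%:R.
  by have := mset_leq_size A i; lia.
case: (eqVneq (size A) k) => [Ak|_]; last by rewrite big1.
rewrite big_nat_truncate; last by rewrite -Ak ltnS mset_leq_size.
by rewrite sumr_const_nat subn0.
Qed.

End Newton.

(** * The involution on elementary functions *)

Section Omega.
Variables (R : comNzRingType) (om : sseries R -> sseries R).
Hypothesis omP : is_omega om.

Lemma omega_pow_sum b k : b || (0 < k)%N ->
  om (pow_sum R b k) = (-1) ^+ (if b then k else k.-1) *: pow_sum R b k.
Proof. by case: omP => _ _ hs ha; case: b => /=; [move=> _; exact: ha | exact: hs]. Qed.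

Lemma omega_mul f g : Lam f -> Lam g -> om (smul f g) = smul (om f) (om g).
Proof. by case: omP => _ [_ h] _ _; exact: h. Qed.

Lemma omega_one : om (@sone R) = @sone R.
Proof. by case: omP => _ []. Qed.

Lemma omega_lincomb I (r : seq I) (c : I -> R) (f : I -> sseries R) :
  (forall i, Lam (f i)) -> om (\sum_(i <- r) c i *: f i) = \sum_(i <- r) c i *: om (f i).
Proof. by case: omP => h _ _ _; exact: linear_on_LamE. Qed.

Definition omega_exponent (w : seq (bool * nat)) : nat :=
  \sum_(x <- w) (if x.1 then x.2 else x.2.-1).

Lemma omega_pow_word w : word_valid w ->
  om (pow_word R w) = (-1) ^+ omega_exponent w *: pow_word R w.
Proof.
rewrite /omega_exponent; elim: w => [|x w IH] /=.
  by rewrite big_nil pow_word_nil omega_one expr0 scale1r.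
move=> /andP[vx vw]; rewrite pow_word_cons omega_mul ?omega_pow_sum ?IH ?big_cons //.
- by rewrite smulZl smulZr scalerA -exprD.
- exact: Lam_pow_sum.
- exact: Lam_pow_word.
Qed.

Lemma Lam_prod (s : seq nat) (g : nat -> sseries R) : (forall k, Lam (g k)) ->
  Lam (\big[@smul R/@sone R]_(k <- s) g k).
Proof.
move=> h; elim: s => [|k s IH]; first by rewrite big_nil; exact: Lam_one.
by rewrite big_cons; exact: Lam_mul.
Qed.

Lemma omega_prod (s : seq nat) (g g' : nat -> sseries R) :
  (forall k, Lam (g k)) -> (forall k, om (g k) = g' k) ->
  om (\big[@smul R/@sone R]_(k <- s) g k) = \big[@smul R/@sone R]_(k <- s) g' k.
Proof.
move=> h e; elim: s => [|k s IH]; first by rewrite !big_nil omega_one.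
by rewrite !big_cons omega_mul ?e ?IH //; exact: Lam_prod.
Qed.

End Omega.

Section OmegaElem.
Variable om : sseries rat -> sseries rat.
Hypothesis omP : is_omega om.

Lemma elem_s0 : elem_s rat 0 = @sone rat.
Proof.
apply: (@fermionicE _ 0); [exact: fermionic_elem_s | exact: fermionic_one |].
move=> I A /cardfs0_eq ->; rewrite elem_sE /sone xpair_eqE eqxx size_mset_eq0.
case: eqP => [->|_]; last by rewrite andbF.
by have -> : squarefree mset0 by apply/allP => x; rewrite msuppE in_mset0.
Qed.

Lemma hom_s0 : hom_s rat 0 = @sone rat.
Proof.
apply: (@fermionicE _ 0); [exact: fermionic_hom_s | exact: fermionic_one |].
by move=> I A /cardfs0_eq ->; rewrite hom_sE /sone xpair_eqE eqxx size_mset_eq0.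
Qed.

(** The sign $(-1)^j$ of [omega] on $p_{j+1}$ removes the sign in [elem_s_newton], so both sides
    obey the same recursion. Membership in [Lam] is carried along because [omega] is controlled only
    there. *)
Lemma omega_elem_s r : Lam (elem_s rat r) /\ om (elem_s rat r) = hom_s rat r.
Proof.
have [n] := ubnP r; elim: n r => // n IH [|r].
  by rewrite elem_s0 hom_s0 (omega_one omP); split=> //; exact: Lam_one.
rewrite ltnS => rn; have r0 : r.+1%:R != 0 :> rat by rewrite pnatr_eq0.
(* Rational coefficients allow the division that turns the Newton identities into recursions. *)
have e f : f = r.+1%:R^-1 *: (r.+1%:R *: f) :> sseries rat by rewrite scalerA mulVf // scale1r.
have IHj j : Lam (elem_s rat (r.+1 - j.+1)) /\ om (elem_s rat (r.+1 - j.+1)) = hom_s rat (r.+1 - j.+1).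
  by apply: IH; lia.
have Lt j : Lam (smul (pow_sum rat false j.+1) (elem_s rat (r.+1 - j.+1))).
  by apply: Lam_mul; [exact: Lam_pow_sum | exact: (IHj j).1].
have Ls : Lam (r.+1%:R *: elem_s rat r.+1).
  by rewrite elem_s_newton; apply: Lam_sum => j; apply: LamZ.
have Lr : Lam (elem_s rat r.+1) by rewrite [elem_s _ _]e; exact: LamZ.
split=> //; rewrite [RHS]e hom_s_newton [LHS]e; congr (_ *: _).
have [SL _ _ _] := omP; have [_ _ SZ] := SL.
rewrite -SZ // elem_s_newton (omega_lincomb omP) //; apply: eq_bigr => j _.
rewrite (omega_mul omP) ?(omega_pow_sum omP) ?(IHj j).2 //; [|exact: Lam_pow_sum|exact: (IHj j).1].
by rewrite smulZl scalerA -exprD addnn -signr_odd odd_double.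
Qed.

Lemma omega_elem_a k : Lam (elem_a rat k) /\ om (elem_a rat k) = hom_a rat k.
Proof.
have Lt j : Lam (smul (pow_sum rat true j) (elem_s rat (k - j))).
  by apply: Lam_mul; [exact: Lam_pow_sum | exact: (omega_elem_s _).1].
split; first by rewrite elem_a_newton; apply: Lam_sum => j; apply: LamZ.
rewrite elem_a_newton hom_a_newton (omega_lincomb omP) //; apply: eq_bigr => j _.
rewrite (omega_mul omP) ?(omega_pow_sum omP) ?(omega_elem_s _).2 //;
  [|exact: Lam_pow_sum|exact: (omega_elem_s _).1].
by rewrite smulZl scalerA -exprD addnn -signr_odd odd_double.
Qed.

Lemma Lam_sp_elem L : Lam (sp_elem rat L).
Proof. by apply: Lam_mul; apply: Lam_prod => k; [case: (omega_elem_a k) | case: (omega_elem_s k)]. Qed.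

Lemma omega_sp_elem L : om (sp_elem rat L) = sp_hom rat L.
Proof.
rewrite /sp_elem /sp_prod (omega_mul omP); first last.
- by apply: Lam_prod => k; case: (omega_elem_s k).
- by apply: Lam_prod => k; case: (omega_elem_a k).
by congr smul; apply: (omega_prod omP) => k; case: (omega_elem_s k); case: (omega_elem_a k).
Qed.

End OmegaElem.

(** * The antipode compared with the involution on products of power sums *)

Definition sp_word (L : superpart) : seq (bool * nat) :=
  [seq (true, k) | k <- spa L] ++ [seq (false, r) | r <- sps L].

Lemma sp_powE (R : comNzRingType) L : sp_pow R L = pow_word R (sp_word L).
Proof. by rewrite pow_word_cat /pow_word !big_map. Qed.

Lemma sp_word_valid L : word_valid (sp_word L).
Proof.
rewrite /word_valid all_cat !all_map; apply/andP; split; first exact/allP.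
have /and3P[_ _ s0] := sp_valP L; apply/allP => -[|k] //= ks.
by move: s0; rewrite ks.
Qed.

(** A bosonic letter [r] accounts for [(r - 1) + 1], a fermionic letter [k] for [k + 1]. *)
Lemma sp_word_exponent L :
  (omega_exponent (sp_word L) + size (sp_word L) = tdeg L + fdeg L)%N.
Proof.
rewrite /omega_exponent big_cat !big_map /= size_cat !size_map /tdeg sumn_cat /fdeg.
have -> : (\sum_(k <- spa L) k = sumn (spa L))%N by rewrite sumnE.
have : (\sum_(r <- sps L) r.-1 + size (sps L) = sumn (sps L))%N; last by lia.
have /and3P[_ _] := sp_valP L; rewrite -/(sps L).
elim: (sps L) => [|[|r] s IH] //=; rewrite ?big_nil // big_cons.
by rewrite inE negb_or /= => /IH; lia.
Qed.

Lemma antipode_sp_pow (R : comNzRingType) (S om : sseries R -> sseries R) L :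
  is_antipode S -> is_omega om ->
  S (sp_pow R L) = (-1) ^+ (fdeg L + tdeg L) *: om (sp_pow R L).
Proof.
move=> SP omP; have vL := sp_word_valid L.
rewrite sp_powE (antipode_pow_word SP) // (omega_pow_word omP) // scalerA -exprD.
congr (_ *: _); apply: signr_parity; have := sp_word_exponent L; lia.
Qed.

(** * Power sums span *)

Definition swap (i j x : nat) : nat := if x == i then j else if x == j then i else x.

Lemma swapK i j : involutive (swap i j).
Proof.
move=> x; rewrite /swap; case: (eqVneq x i) => [->|xi].
  by case: (eqVneq j i) => [->|] //; rewrite eqxx.
case: (eqVneq x j) => [->|xj]; first by rewrite eqxx.
by rewrite (negPf xi) (negPf xj).
Qed.

Lemma swap_bij i j : bijective (swap i j).
Proof. by exists (swap i j); exact: swapK. Qed.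

(** [symm] quantifies over bijections of all of [nat], so a matching of two lists has to be
    extended; a transposition corrects one entry at a time. *)
Lemma bij_map_seq (v w : seq nat) : uniq v -> uniq w -> size v = size w ->
  exists2 u, bijective u & map u v = w.
Proof.
elim: v w => [|x v IH] [|y w] //=; first by move=> _ _ _; exists id => //; exists id.
move=> /andP[xv uv] /andP[yw uw] [/(IH _ uv uw)[u ub uvw]].
exists (swap (u x) y \o u); first exact: bij_comp (swap_bij _ _) ub.
rewrite /= {1}/swap eqxx; congr cons; rewrite -uvw; apply/eq_in_map => z zv /=.
have zy : u z != y by apply: contraNneq yw => <-; rewrite -uvw map_f.
have zx : u z != u x by rewrite (inj_eq (bij_inj ub)); apply: contraNneq xv => <-.
by rewrite /swap (negPf zx) (negPf zy).
Qed.

Lemma mono_term_map u (a s v : seq nat) : injective u ->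
  (mono_term a s (map u v)).2 = smon_ren u (mono_term a s v).2.
Proof.
move=> uI; apply: smonP => [x|x].
  rewrite /= -map_take; apply/imfsetP/imfsetP => /= [[y /mapP[z zv ->] ->]|[y /imfsetP[z /= zv ->] ->]].
    by exists z => //; apply/imfsetP; exists z.
  by exists (u z); rewrite ?map_f.
rewrite smon_renE /= mset_seqE (permP (perm_eq_seq_mset _)).
elim: v (a ++ s) => [|y v IH] [|k c] //=.
by rewrite !count_cat IH !count_nseq.
Qed.

Definition homogeneous (R : comNzRingType) (n d : nat) (f : sseries R) : Prop :=
  forall m, f m != 0 -> #|` m.1| = d /\ size m.2 = n.

Section Homogeneous.
Variable R : comNzRingType.
Implicit Types f g : sseries R.

Lemma homogeneous_one : homogeneous 0 0 (@sone R).
Proof.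
move=> m; rewrite /sone; case: (m =P smon_one) => [-> _|]; last by rewrite eqxx.
by rewrite cardfs0 /= enum_mset0.
Qed.

Lemma homogeneous_mul n1 d1 n2 d2 f g : homogeneous n1 d1 f -> homogeneous n2 d2 g ->
  homogeneous (n1 + n2) (d1 + d2) (smul f g).
Proof.
move=> hf hg m; rewrite /smul smultE => m0.
have [p pm]: exists2 p, p \in divisors m & (f p.1 != 0) && (g p.2 != 0).
  apply: contraPP m0 => h; apply/negP; rewrite negbK big_seq big1 // => p pm.
  rewrite /tens; have [->|f0] := eqVneq (f p.1) 0; first by rewrite mul0r mulr0.
  have [->|g0] := eqVneq (g p.2) 0; first by rewrite !mulr0.
  by case: h; exists p; rewrite ?f0 ?g0.
move: pm; rewrite mem_divisors => /andP[d /eqP <-] /andP[/hf[<- <-] /hg[<- <-]].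
by rewrite /= cardfsU (disjoint_fsetI0 d) cardfs0 subn0 size_msetD.
Qed.

Lemma homogeneous_pow_sum (b : bool) k : homogeneous k b (pow_sum R b k).
Proof. by move=> m /pow_sum_neq0[i ->]; rewrite card_pow_mon size_pow_mon. Qed.

Lemma homogeneous_lincomb n d I (r : seq I) (c : I -> R) (F : I -> sseries R) :
  (forall i, homogeneous n d (F i)) -> homogeneous n d (\sum_(i <- r) c i *: F i).
Proof.
move=> h m; rewrite lincombE => m0.
have [//|nm] := pselect (#|` m.1| = d /\ size m.2 = n).
case/negP: m0; apply/eqP/big1 => i _.
by have [->|/h//] := eqVneq (F i m) 0; rewrite mulr0.
Qed.

Lemma homogeneous_pow_word w :
  homogeneous (sumn [seq x.2 | x <- w]) (word_fdeg w) (pow_word R w).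
Proof.
elim: w => [|x w IH]; first by rewrite pow_word_nil; exact: homogeneous_one.
rewrite pow_word_cons; exact: homogeneous_mul (@homogeneous_pow_sum _ _) IH.
Qed.

Lemma homogeneous_sp_pow L : homogeneous (tdeg L) (fdeg L) (sp_pow R L).
Proof.
rewrite sp_powE; have := @homogeneous_pow_word (sp_word L).
rewrite map_cat -!map_comp !map_id /word_fdeg count_cat !count_map.
by rewrite (eq_count (a2 := predT)) // count_predT (eq_count (a2 := pred0)) // count_pred0 addn0.
Qed.

Lemma Lam_sp_pow L : Lam (sp_pow R L).
Proof. by rewrite sp_powE; exact: Lam_pow_word. Qed.

(** One representative of each orbit of monomials under renaming; symmetry prescribes the other
    values up to a known sign. *)
Definition canonical_mon (L : superpart) : smon :=
  (mono_term (spa L) (sps L) (iota 0 (size (spa L ++ sps L)))).2.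

Lemma occurs_ren L m : occurs L m ->
  exists2 u, bijective u & m = smon_ren u (canonical_mon L).
Proof.
move=> [v [uv sv <-]].
have [u ub uv'] := bij_map_seq (iota_uniq 0 (size v)) uv (size_iota _ _).
by exists u; rewrite // /canonical_mon -mono_term_map -?sv ?uv' //; exact: bij_inj.
Qed.

End Homogeneous.

Section Span.

(** Since the transposition fixes the monomial but reverses its sign, symmetric functions vanish
    there. This disposes of the monomials to which [occurs_exists] does not apply. *)
Lemma ren_sign_swap (m : smon) i j : i \in m.1 -> j \in m.1 -> i != j -> m.2 i = m.2 j ->
  smon_ren (swap i j) m = m /\ odd (ren_sign (swap i j) m).
Proof.
move=> im jm ij e; have sI := can_inj (@swapK i j).
have e1 x : m.2 (swap i j x) = m.2 x.
  by rewrite /swap; case: eqP => [->|_] //; case: eqP => [->|].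
have e2 x : (swap i j x \in m.1) = (x \in m.1).
  by rewrite /swap; case: eqP => [->|_]; [rewrite im jm | case: eqP => [->|] //; rewrite im jm].
split.
  apply: smonP => [x|x].
    apply/imfsetP/idP => /= [[y ym ->]|xm]; first by rewrite e2.
    by exists (swap i j x); rewrite ?e2 ?swapK.
  rewrite smon_renE -[RHS]e1 -count_mem_mset; apply: eq_count => y /=.
  by rewrite -{1}(swapK i j x) (inj_eq sI).
pose r := [seq x <- m.1 | (x != i) && (x != j)].
have rE : map (swap i j) r = r.
  rewrite -[RHS]map_id; apply/eq_in_map => x; rewrite mem_filter => /andP[/andP[xi xj] _].
  by rewrite /swap (negPf xi) (negPf xj).
(* With [i] and [j] listed first, every contribution occurs twice except that of the pair itself. *)
rewrite /ren_sign (@inv_map_sort _ m.1 (i :: j :: r) sI).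
- rewrite /= rE /swap eqxx eq_sym (negPf ij) eqxx.
  have : ((i < j) + (j < i) = 1)%N by case: ltngtP ij.
  rewrite !oddD; case: (ltngtP i j) ij => //= _ _ _; by do 3!case: (odd _).
- by rewrite /= inE (negPf ij) !mem_filter !eqxx !andbF /= filter_uniq ?fset_uniq.
- move=> x; rewrite !inE mem_filter; case: eqP => [->|_] /=; first by rewrite im.
  by case: eqP => [->|_] //=; rewrite jm.
Qed.

Lemma Lam_eq0 n d (f : sseries rat) : Lam f -> homogeneous n d f ->
  (forall L, tdeg L = n -> fdeg L = d -> f (canonical_mon L) = 0) -> f = 0.
Proof.
move=> [_ sf] hf f0; apply/funext => m; apply/eqP; apply: contrapT => /negP fm.
have [md mn] := hf _ fm.
have [mI|] := pselect ({in m.1 &, injective m.2}).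
  have [L oL] := occurs_exists mI; have [Ld Ln] := occurs_deg oL.
  have [u ub e] := occurs_ren oL; move: fm.
  by rewrite e sf // f0 ?mulr0 ?eqxx -?Ln -?Ld.
apply=> i j im jm e; apply/eqP; apply: contrapT => /negP ij.
have [e1 e2] := ren_sign_swap im jm ij e.
have := sf _ (swap_bij i j) m; rewrite e1 -signr_odd e2 expr1 mulN1r => /eqP.
by rewrite -addr_eq0 -mulr2n mulrn_eq0 /= (negPf fm).
Qed.

Lemma weight_neq0 L : weight L != 0.
Proof.
rewrite /weight pnatr_eq0 -lt0n /zpart big_nat; apply: prodn_cond_gt0 => i /andP[i0 _].
by rewrite muln_gt0 expn_gt0 i0 fact_gt0.
Qed.

Lemma sp_pow_free scal (s : seq superpart) (c : superpart -> rat) :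
  is_scalar_product weight scal -> uniq s ->
  \sum_(L <- s) c L *: sp_pow rat L = 0 -> {in s, forall L, c L = 0}.
Proof.
move=> [sb sp] us c0 M Ms.
have scal0 g : Lam g -> scal 0 g = 0.
  move=> Lg; have [+ _] := sb 1 0 0 g (Lam0 _) (Lam0 _) Lg.
  by rewrite scaler0 addr0 mul1r => /eqP; rewrite -subr_eq0 opprD addrA subrr sub0r oppr_eq0 => /eqP.
have scal_sum : scal (\sum_(L <- s) c L *: sp_pow rat L) (sp_pow rat M) =
    \sum_(L <- s) c L * scal (sp_pow rat L) (sp_pow rat M).
  have LM := Lam_sp_pow rat M; elim: (s) => [|L r IH]; first by rewrite !big_nil scal0.
  rewrite !big_cons -IH; apply: (sb _ _ _ _ _ _ LM).1; first exact: Lam_sp_pow.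
  by apply: Lam_sum => N; apply: LamZ; exact: Lam_sp_pow.
move: scal_sum; rewrite c0 scal0; last exact: Lam_sp_pow.
rewrite (bigD1_seq M) //= sp eqxx big1 ?addr0.
  by move/esym/eqP; rewrite mulf_eq0 (negPf (weight_neq0 M)) orbF => /eqP.
by move=> L LM; rewrite sp (negPf LM) mulr0.
Qed.

Lemma sp_pow_span scal n d (f : sseries rat) : is_scalar_product weight scal ->
  Lam f -> homogeneous n d f -> exists c : superpart -> rat,
  f = \sum_(L <- fset_set (type_set n d)) c L *: sp_pow rat L.
Proof.
move=> sP Lf hf; pose s := enum_fset (fset_set (type_set n d)).
have us : uniq s by exact: fset_uniq.
have sE L : (L \in s) = (tdeg L == n) && (fdeg L == d).
  rewrite in_fset_set; last exact: finite_type.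
  by apply/idP/andP; rewrite inE => -[/eqP ? /eqP ?].
have L0 : superpart by exact: (Superpart (elem_s_superpartP 0)).
pose p i := sp_pow rat (nth L0 s i).
have hp i : (i < size s)%N -> homogeneous n d (p i).
  move=> /(mem_nth L0); rewrite sE => /andP[/eqP <- /eqP <-]; exact: homogeneous_sp_pow.
(* Rows and columns are both indexed by the superpartitions of the type, so [M] is square. A row
   vector killed by [M] gives a combination vanishing at all canonical monomials, hence zero, hence
   trivial by [sp_pow_free]. *)
pose M : 'M[rat]_(size s) := \matrix_(i, j) p i (canonical_mon (nth L0 s j)).
have comb (v : 'rV[rat]_(size s)) : exists2 c : superpart -> rat,
    forall i : 'I_(size s), c (nth L0 s i) = v 0 i &
    \sum_(i < size s) v 0 i *: p i = \sum_(L <- s) c L *: sp_pow rat L.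
  pose c L := if insub (index L s) is Some i then v 0 i else 0.
  have cE (i : 'I_(size s)) : c (nth L0 s i) = v 0 i.
    by rewrite /c index_uniq // valK.
  exists c => //; rewrite (big_nth L0) big_mkord; apply: eq_bigr => i _.
  by rewrite cE.
have vanish (g : sseries rat) (Lg : Lam g) (hg : homogeneous n d g) :
    (forall i : 'I_(size s), g (canonical_mon (nth L0 s i)) = 0) -> g = 0.
  move=> g0; apply: (Lam_eq0 Lg hg) => L Ln Ld.
  have Ls : L \in s by rewrite sE Ln Ld !eqxx.
  have iL : (index L s < size s)%N by rewrite index_mem.
  by have := g0 (Ordinal iL); rewrite /= nth_index.
have Lc (v : 'rV[rat]_(size s)) : Lam (\sum_(i < size s) v 0 i *: p i).
  by apply: Lam_sum => i; apply: LamZ; exact: Lam_sp_pow.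
have hc (v : 'rV[rat]_(size s)) : homogeneous n d (\sum_(i < size s) v 0 i *: p i).
  by apply: homogeneous_lincomb => i; exact: hp.
have ev (v : 'rV[rat]_(size s)) (j : 'I_(size s)) :
    (\sum_(i < size s) v 0 i *: p i) (canonical_mon (nth L0 s j)) = (v *m M) 0 j.
  by rewrite lincombE mxE; apply: eq_bigr => i _; rewrite mxE.
have Mfree : M \in unitmx.
  rewrite -row_free_unit; apply: inj_row_free => v vM.
  have [c cE vc] := comb v.
  have /(sp_pow_free sP us) c0 : \sum_(L <- s) c L *: sp_pow rat L = 0.
    by rewrite -vc; apply: vanish => // j; rewrite ev vM mxE.
  by apply/rowP => i; rewrite mxE -cE c0 // mem_nth.
(* [r *m invmx M] matches [f] at all canonical monomials, and [vanish] kills the difference. *)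
pose r : 'rV[rat]_(size s) := \row_j f (canonical_mon (nth L0 s j)).
have [c _ vc] := comb (r *m invmx M); exists c; rewrite -vc.
apply/eqP; rewrite -subr_eq0; apply/eqP; apply: vanish.
- by rewrite -scaleN1r; apply: LamD => //; exact: LamZ.
- move=> m; have [f0|/hf//] := eqVneq (f m) 0.
  have -> : (f - \sum_(i < size s) (r *m invmx M) 0 i *: p i) m =
    f m - (\sum_(i < size s) (r *m invmx M) 0 i *: p i) m by [].
  by rewrite f0 sub0r oppr_eq0 => /hc.
- move=> j; set g := \sum_(i < _) _.
  have -> : (f - g) (canonical_mon (nth L0 s j)) = (f (canonical_mon (nth L0 s j)) : rat) -
      g (canonical_mon (nth L0 s j)) by [].
  by rewrite /g ev mulmxKV // mxE subrr.
Qed.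

End Span.

(** * Specializations of the Macdonald basis *)

Section Specialization.

(** Cross multiplication gives an identity of polynomials, which may be evaluated at $q=t=0$, where
    both denominators are nonzero. *)
Lemma spec_zero_inj F c c' : spec_zero F c -> spec_zero F c' -> c = c'.
Proof.
move=> [a [b [b0 -> ->]]] [a' [b' [b0' e ->]]].
have nz (p : Qpoly_qt) : p.[0].[0] != 0 -> p != 0 by apply: contra_neq => ->; rewrite !horner0.
have {e} : a * b' = a' * b.
  move/eqP: e; rewrite eqr_div ?tofrac_eq0 ?nz // -!tofracM tofrac_eq => /eqP.
  by [].
move/(congr1 (fun p : Qpoly_qt => p.[0].[0])); rewrite !hornerM => /eqP e.
by apply/eqP; rewrite eqr_div.
Qed.

Lemma spec_zeroN F c : spec_zero F c -> spec_zero (- F) (- c).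
Proof.
move=> [a [b [b0 -> ->]]]; exists (- a), b; split=> //; first by rewrite tofracN mulNr.
by rewrite !hornerN mulNr.
Qed.

(** Bundling as ring morphisms makes [eval_inv], by conversion, a composite of morphisms. *)
Definition Qqt_cst_morph : {rmorphism rat -> Qqt} := (@tofrac Qpoly_qt \o polyC \o polyC).

Definition eval_q : {rmorphism {poly rat} -> Qqt} := (horner_eval qpar^-1 \o map_poly Qqt_cst_morph).

Lemma eval_invE a : eval_inv a = (horner_eval tpar^-1 \o map_poly eval_q) a.
Proof. by []. Qed.

Lemma sum_reverse_coef (A : nzRingType) n (c : nat -> A) (i : nat) : (i < n)%N ->
  (\sum_(k < n) c k *: 'X^(n - k))`_(n - i) = c i.
Proof.
move=> ltin; rewrite coef_sum (bigD1 (Ordinal ltin)) //= coefZ coefXn eqxx mulr1.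
rewrite big1 ?addr0 // => k ki; rewrite coefZ coefXn; case: eqP => [e|_]; last by rewrite mulr0.
by case/eqP: ki; apply: val_inj => /=; have := ltn_ord k; lia.
Qed.

Lemma horner_inv_mul (A : nzRingType) (K : fieldType) (phi : {rmorphism A -> K})
    (x : K) (p : {poly A}) n : x != 0 -> (size p <= n)%N ->
  (map_poly phi p).[x^-1] * x ^+ n = \sum_(j < n) phi p`_j * x ^+ (n - j).
Proof.
move=> x0 pn; rewrite (@horner_coef_wide _ n); last exact: leq_trans (size_poly _ _) pn.
rewrite mulr_suml; apply: eq_bigr => j _; rewrite coef_map -mulrA; congr (_ * _).
move: (nat_of_ord j) (ltnW (ltn_ord j)) => i jn.
by rewrite -{1}(subnKC jn) exprD mulrA -exprMn mulVf // expr1n mul1r.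
Qed.

(** Multiplying $b(1/q,1/t)$ by $q^Nt^n$ gives a polynomial with the coefficients of [b] in reversed
    order, so nothing is lost. This justifies the cross multiplication in [spec_infty_inj]. *)
Lemma eval_inv_neq0 (b : Qpoly_qt) : b != 0 -> eval_inv b != 0.
Proof.
apply: contra_neq => b0; pose n := size b.
pose N := (\max_(i < n) size (b`_i)%R)%N.
have bN i : (size (b`_i)%R <= N)%N.
  have [ltin|ni] := ltnP i n; last by rewrite nth_default // size_poly0.
  exact: (@leq_bigmax _ (fun i : 'I_n => size (b`_i)%R) (Ordinal ltin)).
have q0 : qpar != 0 by rewrite tofrac_eq0 polyC_eq0 polyX_eq0.
have t0 : tpar != 0 by rewrite tofrac_eq0 polyX_eq0.
(* The reversal in $q$ of the coefficient of $t^i$; [N] bounds all the sizes, so that one power of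
   $q$ serves every [i]. *)
pose c i : {poly rat} := \sum_(j < N) b`_i`_j *: 'X^(N - j).
have ec i : eval_q b`_i * qpar ^+ N = tofrac ((c i)%:P : Qpoly_qt).
  have := horner_inv_mul Qqt_cst_morph q0 (bN i).
  rewrite -[(map_poly _ _).[_]]/(eval_q b`_i) => ->.
  have -> : (c i)%:P = \sum_(j < N) (b`_i`_j)%:P%:P * ('X%:P ^+ (N - j)) :> Qpoly_qt.
    rewrite raddf_sum; apply: eq_bigr => j _.
    by rewrite /= -mul_polyC polyCM polyC_exp.
  rewrite raddf_sum; apply: eq_bigr => j _.
  by rewrite /= tofracM tofracXn.
have : tofrac (\sum_(i < n) (c i) *: 'X^(n - i) : Qpoly_qt) = 0.
  transitivity (eval_inv b * tpar ^+ n * qpar ^+ N); last by rewrite b0 !mul0r.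
  have := horner_inv_mul eval_q t0 (leqnn n).
  rewrite -[(map_poly _ _).[_]]/(eval_inv b) => ->.
  rewrite mulr_suml raddf_sum; apply: eq_bigr => i _.
  rewrite mulrAC ec -mul_polyC /= tofracM; congr (_ * _).
  exact: tofracXn.
move/eqP; rewrite tofrac_eq0 => /eqP B0; apply/polyP => i; apply/polyP => j.
rewrite !coef0; have [ltin|ni] := ltnP i n; last by rewrite [b`_i]nth_default // coef0.
have [ltjN|Nj] := ltnP j N; last by rewrite nth_default // (leq_trans (bN i)).
rewrite -(sum_reverse_coef (fun j => b`_i`_j) ltjN) -/(c i).
by rewrite -(sum_reverse_coef c ltin) B0 !coef0.
Qed.

Lemma eval_invM : {morph eval_inv : a b / a * b}.
Proof. by move=> a b; rewrite !eval_invE rmorphM. Qed.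

Lemma spec_infty_inj F c c' : spec_infty F c -> spec_infty F c' -> c = c'.
Proof.
move=> [a [b [b0 -> h]]] [a' [b' [b0' e h']]]; apply: spec_zero_inj h _.
suff -> : eval_inv a / eval_inv b = eval_inv a' / eval_inv b' by [].
apply/eqP; rewrite eqr_div ?eval_inv_neq0 // -!eval_invM; apply/eqP; congr eval_inv.
by apply/eqP; rewrite -tofrac_eq !tofracM -eqr_div ?tofrac_eq0 //; apply/eqP.
Qed.

Lemma spec_inftyN F c : spec_infty F c -> spec_infty (- F) (- c).
Proof.
move=> [a [b [b0 -> h]]]; exists (- a), b; split=> //; first by rewrite tofracN mulNr.
by rewrite eval_invE rmorphN mulNr; exact: spec_zeroN.
Qed.

(** Both specializations are treated at once. Uniqueness and compatibility with negation suffice: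
    symmetry involves only the signs $\pm1$, and homogeneity only the value 0. *)
Variable spec : Qqt -> rat -> Prop.
Hypothesis spec_inj : forall F c c', spec F c -> spec F c' -> c = c'.
Hypothesis specN : forall F c, spec F c -> spec (- F) (- c).

Lemma spec0 c : spec 0 c -> c = 0.
Proof.
move=> h; have := specN h; rewrite oppr0 => /(spec_inj h)/eqP.
by rewrite -addr_eq0 -mulr2n mulrn_eq0 => /eqP.
Qed.

Variables (B : sseries Qqt -> sseries Qqt -> Qqt) (P : superpart -> sseries Qqt)
  (s : superpart -> sseries rat).
Hypotheses (PB : is_macdonald B P) (Ps : sseries_spec spec P s).

Lemma homogeneous_mono (R : comNzRingType) L : homogeneous (tdeg L) (fdeg L) (sp_mono R L).
Proof. by move=> m /sp_mono_neq0/occurs_deg. Qed.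

(** The order [sp_lt] relates only superpartitions of equal degrees, so triangularity fixes the
    type. *)
Lemma homogeneous_macdonald L : homogeneous (tdeg L) (fdeg L) (P L).
Proof.
have [_ /(_ L)[r rL ->] _] := PB; rewrite big_seq.
move=> m; have [//|nm] := pselect (#|` m.1| = fdeg L /\ size m.2 = tdeg L).
have z M : tdeg M = tdeg L -> fdeg M = fdeg L -> sp_mono Qqt M m = 0.
  by move=> eM1 eM2; have [//|/homogeneous_mono] := eqVneq (sp_mono Qqt M m) 0; rewrite eM1 eM2.
suff -> : (sp_mono Qqt L + \sum_(p <- r | p \in r) p.1 *: sp_mono Qqt p.2) m = 0 by rewrite eqxx.
transitivity ((sp_mono Qqt L m : Qqt) + (\sum_(p <- r | p \in r) p.1 *: sp_mono Qqt p.2) m).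
  by [].
rewrite z // add0r fct_sumE big1 // => p /rL[[h1 h2 _ _] _].
by transitivity (p.1 * (sp_mono Qqt p.2 m : Qqt)); rewrite // z ?mulr0.
Qed.

Lemma homogeneous_spec L : homogeneous (tdeg L) (fdeg L) (s L).
Proof.
move=> m s0; apply: homogeneous_macdonald; apply: contra_neq s0 => P0.
by apply: spec0; rewrite -P0; exact: Ps.
Qed.

Lemma Lam_spec L : Lam (s L).
Proof.
split.
  exists (fdeg L + tdeg L)%N => m; apply: contraTeq => /homogeneous_spec[m1 m2].
  by rewrite /smon_deg m1 m2 ltnn.
move=> u ub m; have [[LP _ _] _ _] := PB; have [_ /(_ u ub m)] := LP L.
have := Ps L (smon_ren u m); have := Ps L m.
rewrite -![(-1) ^+ ren_sign u m]signr_odd; case: odd; rewrite ?expr1 ?expr0 ?mulN1r ?mul1r.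
  by move=> /specN h1 h2 e; rewrite e in h2; exact: spec_inj h2 h1.
by move=> h1 h2 e; rewrite e in h2; exact: spec_inj h2 h1.
Qed.

End Specialization.

(** * Conjugation and the final argument *)

Lemma fdeg_conj L : fdeg (conj L) = fdeg L.
Proof. by rewrite /fdeg /spa /= size_rev size_map. Qed.

(** The multiplicity of [x + 1] is the difference of the counts above [x] and above [x + 1]; the
    entry 0, which these counts miss, is excluded. *)
Lemma perm_count_gt (s t : seq nat) : 0%N \notin s -> 0%N \notin t ->
  (forall j, count (fun k => j < k)%N s = count (fun k => j < k)%N t) -> perm_eq s t.
Proof.
move=> s0 t0 st; apply/allP => -[|x] _ /=; first by rewrite (count_memPn s0) (count_memPn t0).
have h (r : seq nat) : (count_mem x.+1 r + count (fun k => x.+1 < k) r =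
    count (fun k => x < k) r)%N.
  by elim: r => //= y r <-; case: ltngtP; lia.
by have := st x; rewrite -!h st => /addIn ->.
Qed.

Lemma colh_conjK L j : colh (conj (conj L)) j = colh L j.
Proof.
have h i : (i < colh (conj (conj L)) j)%N = (i < colh L j)%N by rewrite !colh_conj.
by have := h (colh L j); have := h (colh (conj (conj L)) j); rewrite !ltnn; lia.
Qed.

(** Transposing twice restores circles and column heights; circles determine [spa L], and the
    heights then determine [sps L]. The dualities taken at [conj L] call for this. *)
Lemma conjK L : conj (conj L) = L.
Proof.
have sa : spa (conj (conj L)) =i spa L.
  move=> j; have h M : (j \in spa M) = circle M (colh M j) j by rewrite circleE eqxx andbT.
  by rewrite !h !circle_conj colh_conjK.
have pa : perm_eq (spa (conj (conj L))) (spa L) by apply: uniq_perm; rewrite ?spa_uniq.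
apply: superpart_perm => //; apply: perm_count_gt.
- by case/and3P: (sp_valP (conj (conj L))).
- by case/and3P: (sp_valP L).
move=> j; have := colh_conjK L j; rewrite /colh !count_cat (permP pa).
exact: addnI.
Qed.

Lemma homogeneous_prod (R : comNzRingType) (w : seq nat) d (g : nat -> sseries R) :
  (forall k, homogeneous k d (g k)) ->
  homogeneous (sumn w) (d * size w) (\big[@smul R/@sone R]_(k <- w) g k).
Proof.
move=> h; elim: w => [|k w IH]; first by rewrite big_nil muln0; exact: homogeneous_one.
by rewrite big_cons mulnS; exact: homogeneous_mul.
Qed.

Lemma homogeneous_sp_elem (R : comNzRingType) L :
  homogeneous (tdeg L) (fdeg L) (sp_elem R L).
Proof.
rewrite /tdeg sumn_cat -[fdeg L]addn0 -{1}[fdeg L]mul1n -[0%N](mul0n (size (sps L))).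
apply: homogeneous_mul; apply: homogeneous_prod => k.
  have := @homogeneous_mono R (Superpart (elem_a_superpartP k)).
  by rewrite /tdeg /= sumn_nseq mul1n.
have := @homogeneous_mono R (Superpart (elem_s_superpartP k)).
by rewrite /tdeg /= sumn_nseq mul1n.
Qed.

Lemma antipode_omega scal (S om : sseries rat -> sseries rat) n d f :
  is_scalar_product weight scal -> is_antipode S -> is_omega om ->
  Lam f -> homogeneous n d f -> S f = (-1) ^+ (d + n) *: om f.
Proof.
move=> sP SP omP Lf hf; have [c ->] := sp_pow_span sP Lf hf.
have Lp L : Lam (sp_pow rat L) by exact: Lam_sp_pow.
have [SL _ _] := SP; rewrite (linear_on_LamE _ _ SL) // (omega_lincomb omP) // scaler_sumr.
rewrite !big_seq; apply: eq_bigr => L.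
rewrite in_fset_set ?inE; last exact: finite_type.
by move=> [Ln Ld]; rewrite (antipode_sp_pow _ SP omP) Ln Ld scalerA mulrC -scalerA.
Qed.

Theorem corollary4p5
  (scal : sseries rat -> sseries rat -> rat)
  (scal_qt : sseries Qqt -> sseries Qqt -> Qqt)
  (P : superpart -> sseries Qqt)
  (s sbar sstar sbarstar : superpart -> sseries rat)
  (omega antip : sseries rat -> sseries rat)
  (Hscal : is_scalar_product weight scal)
  (Hscal_qt : is_scalar_product weight_qt scal_qt)
  (HP : is_macdonald scal_qt P)
  (Hs : sseries_spec spec_zero P s)
  (Hsbar : sseries_spec spec_infty P sbar)
  (Hsstar : is_dual scal sstar s)
  (Hsbarstar : is_dual scal sbarstar sbar)
  (* the known duality between the two families of Schur functions *)
  (Homega : is_omega omega)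
  (Hdual : forall L : superpart,
     sstar L = (-1) ^+ 'C(fdeg L, 2) *: omega (sbar (conj L)))
  (Hdualbar : forall L : superpart,
     sbarstar L = (-1) ^+ 'C(fdeg L, 2) *: omega (s (conj L)))
  (HS : is_antipode antip)
  (L : superpart) (n m : nat) (Hn : tdeg L = n) (Hm : fdeg L = m) :
  [/\ antip (sp_elem rat L) = (-1) ^+ (m + n) *: sp_hom rat L,
      antip (s L) = (-1) ^+ ('C(m.+1, 2) + n) *: sbarstar (conj L)
    & antip (sbar L) = (-1) ^+ ('C(m.+1, 2) + n) *: sstar (conj L)].
Proof.
have key f : Lam f -> homogeneous (tdeg L) (fdeg L) f ->
    antip f = (-1) ^+ (m + n) *: omega f.
  by rewrite Hn Hm; exact: antipode_omega Hscal HS Homega.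
(* As $\binom{m+1}{2}=\binom m2+m$, the two binomial exponents on the right add up to $m$ modulo 2;
   the inner one is the sign in the dualities. *)
have sgn f : (-1) ^+ (m + n) *: f =
    (-1) ^+ ('C(m.+1, 2) + n) *: ((-1) ^+ 'C(m, 2) *: f) :> sseries rat.
  rewrite scalerA -exprD; congr (_ *: _); apply: signr_parity.
  by rewrite binS bin1 -2!addnA [in RHS]addnC -addnA; lia.
split.
- by rewrite key ?(omega_sp_elem Homega) //; [exact: (Lam_sp_elem Homega) | exact: homogeneous_sp_elem].
- rewrite key ?sgn ?Hdualbar ?conjK ?fdeg_conj ?Hm //.
  + exact: (Lam_spec spec_zero_inj spec_zeroN HP Hs).
  + by rewrite -Hm; exact: (homogeneous_spec spec_zero_inj spec_zeroN HP Hs).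
- rewrite key ?sgn ?Hdual ?conjK ?fdeg_conj ?Hm //.
  + exact: (Lam_spec spec_infty_inj spec_inftyN HP Hsbar).
  + by rewrite -Hm; exact: (homogeneous_spec spec_infty_inj spec_inftyN HP Hsbar).
Qed.
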